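(* Assume (A1)–(A4) and step sizes satisfying (i) $\sum_k\alpha_{ij,k}^2<\infty$ and $\sup_k\alpha_{ij,k+1}/\alpha_{ij,k}<\infty$ for all $(i,j)\in\mathcal{E}$; (ii) $\sum_k\beta_{i,k}^2<\infty$ and $\sup_k\beta_{i,k+1}/\beta_{i,k}<\infty$ for all $i$; (iii) $\sum_k z_k=\infty$ with $z_k=\min\{\alpha_{ij,k}/k^{\nu_{ij}},(i,j)\in\mathcal{E};\beta_{i,k},i\in\mathcal{V}\}$. Then the global average data rate of Algorithm SC satisfies $\mathtt{B}(k)=O(k^{-\underline\nu})$ almost surely, where $\underline\nu=\min_{(i,j)\in\mathcal{E}}\nu_{ij}$.
   Context: Network: undirected weighted graph with sensor set $\mathcal{V}=\{1,\dots,N\}$, symmetric nonnegative weights $a_{ij}=a_{ji}$, with $a_{ij}>0$ iff $(i,j)\in\mathcal{E}$; the edge set $\mathcal{E}$ is regarded as a set of ordered pairs that is symmetric ($(i,j)\in\mathcal{E}\iff(j,i)\in\mathcal{E}$), $M=|\mathcal{E}|/2$ is the number of undirected edges, and $\mathcal{N}_i=\{j:(i,j)\in\mathcal{E}\}$. The Laplacian is $\mathcal{L}=\mathcal{D}-\mathcal{A}$ with $\mathcal{A}=(a_{ij})$, $\mathcal{D}=\mathrm{diag}(\sum_{j\in\mathcal{N}_i}a_{ij})$; $\lambda_2(\mathcal{L})$ is its second smallest eigenvalue. Observations: unknown $\theta\in\mathbb{R}^n$; sensor $i$ observes $y_{i,k}=H_{i,k}\theta+w_{i,k}$, $k\ge1$,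 with deterministic $H_{i,k}\in\mathbb{R}^{m_i\times n}$ and noise $w_{i,k}\in\mathbb{R}^{m_i}$. Let $d_{i,k}$ ($i\in\mathcal{V},k\ge1$) be the dithering noises used below, $\mathcal{F}_k=\sigma(w_{i,t},d_{i,t}: i\in\mathcal{V},1\le t\le k)$ and $\mathcal{F}^w_k=\sigma(w_{i,t}: i\in\mathcal{V},1\le t\le k)$. Assumptions. (A1) There is $\bar H>0$ with $\|H_{i,k}\|\le\bar H$ for all $i,k$, and there are a positive integer $p$ and $\delta>0$ with $\frac1p\sum_{t=k}^{k+p-1}\sum_{i=1}^N H_{i,t}^\top H_{i,t}\ge\delta I_n$ for all $k\ge1$. (A2) $\{w_{i,k},\mathcal{F}_k\}$ is a martingale difference sequence and $\sup_{i,k}\mathbb{E}[\|w_{i,k}\|^\rho\mid\mathcal{F}^w_{k-1}]<\infty$ a.s. for some $\rho>2$. (A3) The graph is connected, i.e. $\mathrm{rank}(\mathcal{L})=N-1$. (A4) The $d_{i,k}$ are i.i.d. with the Laplace distribution $\mathrm{Lap}(0,1)$ (density $f(x)=\frac12e^{-|x|}$, distribution function $F$), mutually independent over all $(i,k)$, and independent of all $w_{j,t}$. Algorithm SC. Inputs: deterministic initial estimates $\hat\theta_{i,0}\in\mathbb{R}^n$; event-triggered coefficients $\nu_{ij}=\nu_{ji}\ge0$; noise coefficients $b_{ij}=b_{ji}>0$; step sizes $\alpha_{ij,k}=\alpha_{ji,k}>0$ ($(i,j)\in\mathcal{E}$) and $\beta_{i,k}>0$. For $k=1,2,\dots$: let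 $\varphi_k\in\mathbb{R}^n$ be the $l$-th standard basis vector, where $k=nq+l$ with $q\in\mathbb{N}\cup\{0\}$, $l\in\{1,\dots,n\}$; set $x_{i,k}=\varphi_k^\top\hat\theta_{i,k-1}$; set $C_{ij,k}=\nu_{ij}b_{ij}\ln k$; set $s_{ij,k}=1$ if $x_{i,k}+b_{ij}d_{i,k}>0$ and $s_{ij,k}=-1$ otherwise. Sensor $i$ sends the one-bit message $s_{ij,k}$ to neighbor $j$ iff $|x_{i,k}+b_{ij}d_{i,k}|>C_{ij,k}$; sensor $i$ sets $\hat s_{ji,k}=s_{ji,k}$ if it received $s_{ji,k}$ from $j$, and $\hat s_{ji,k}=0$ otherwise. With $G_{ij,k}(x)=F((x-C_{ij,k})/b_{ij})-F((-x-C_{ij,k})/b_{ij})$, update $\check\theta_{i,k}=\hat\theta_{i,k-1}+\varphi_k\sum_{j\in\mathcal{N}_i}\alpha_{ij,k}a_{ij}(\hat s_{ji,k}-G_{ij,k}(x_{i,k}))$, $\hat\theta_{i,k}=\check\theta_{i,k}+\beta_{i,k}H_{i,k}^\top(y_{i,k}-H_{i,k}\hat\theta_{i,k-1})$. Data rates: $\zeta_{ij}(t)\in\{0,1\}$ is the number of bits sensor $i$ sends to $j$ at time $t$ (i.e. $1$ iff $|x_{i,t}+b_{ij}d_{i,t}|>C_{ij,t}$). Local average data rate $\mathtt{B}_{ij}(k)=\frac1k\sum_{t=1}^k\zeta_{ij}(t)$; global average data rate $\mathtt{B}(k)=\frac{1}{2kM}\sum_{(i,j)\in\mathcal{E}}\sum_{t=1}^k\zeta_{ij}(t)$.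 ''$X_k=O(r_k)$ a.s.'' means $\sup_k|X_k|/r_k<\infty$ almost surely. *)

(* Defs.v *)
From HB Require Import structures.
From mathcomp Require Import all_boot all_order all_algebra.
From mathcomp Require Import all_classical all_reals all_analysis.
From mathcomp Require Import measurable_realfun.
Set Implicit Arguments. Unset Strict Implicit. Unset Printing Implicit Defensive.
Import Order.TTheory GRing.Theory Num.Theory.
Import numFieldNormedType.Exports.
Local Open Scope classical_set_scope.
Local Open Scope ring_scope.

Section Prob.
Context {R : realType} {d : measure_display} {T : measurableType d}.
Variable P : probability T R.

Definition measurable_wrt (G : set (set T)) (X : T -> R) : Prop :=
  forall B : set R, measurable B -> G (X @^-1` B).

Definition measurable_wrt_e (G : set (set T)) (Y : T -> \bar R) : Prop :=
  forall B : set (\bar R), measurable B -> G (Y @^-1` B).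

Definition mutually_independent (I : eqType) (F : I -> set (set T)) : Prop :=
  forall (J : seq I), uniq J ->
  forall A : I -> set T, (forall j, j \in J -> F j (A j)) ->
  fine (P (\bigcap_(j in [set j | j \in J]) A j)) = \prod_(j <- J) fine (P (A j)).

Definition is_cond_exp_nonneg (G : set (set T)) (X Y : T -> \bar R) : Prop :=
  (forall x, (0 <= Y x)%E) /\ measurable_wrt_e G Y /\
  forall A, G A -> (\int[P]_(x in A) Y x = \int[P]_(x in A) X x)%E.

Definition cond_exp_zero (G : set (set T)) (X : T -> R) : Prop :=
  P.-integrable setT (EFin \o X) /\
  forall A, G A -> (\int[P]_(x in A) (X x)%:E = 0)%E.

End Prob.

Definition vnorm {R : realType} {m : nat} (v : 'cV[R]_m) : R :=
  Num.sqrt (\sum_(r < m) v r 0 ^+ 2).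

Definition laplace_cdf {R : realType} (x : R) : R :=
  if x < 0 then expR x / 2 else 1 - expR (- x) / 2.

Section AlgSC.
Context {R : realType} {T : Type}.
Variables (N n : nat) (m : 'I_N -> nat).
Variable a : 'I_N -> 'I_N -> R.                 (* weights, edge iff a i j > 0 *)
Variable H : forall i : 'I_N, nat -> 'M[R]_(m i, n).
Variable theta : 'cV[R]_n.
Variable w : forall i : 'I_N, nat -> T -> 'cV[R]_(m i).
Variable dn : 'I_N -> nat -> T -> R.           (* dithering noises d_{i,k} *)
Variable theta0 : 'I_N -> 'cV[R]_n.
Variables (nu b : 'I_N -> 'I_N -> R).
Variable alpha : 'I_N -> 'I_N -> nat -> R.
Variable beta : 'I_N -> nat -> R.

(* phi_k = l-th standard basis vector, k = n q + l, l in {1..n};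
   0-based index (k-1) mod n *)
Definition phi (k : nat) : 'cV[R]_n :=
  \col_(j < n) ((nat_of_ord j == (k.-1 %% n)%N)%:R).

Definition xval (k : nat) (th : 'cV[R]_n) : R := ((phi k)^T *m th) 0 0.

Definition Cthr (i j : 'I_N) (k : nat) : R := nu i j * b i j * ln (k%:R).

Definition Gfun (i j : 'I_N) (k : nat) (x : R) : R :=
  laplace_cdf ((x - Cthr i j k) / b i j) - laplace_cdf ((- x - Cthr i j k) / b i j).

(* s-hat_{ji,k}: what sensor i holds from neighbour j at time k, given
   x_{j,k} *)
Definition shat (j i : 'I_N) (k : nat) (xj : R) (om : T) : R :=
  let v := xj + b j i * dn j k om in
  if Cthr j i k < `|v| then (if 0 < v then 1 else -1) else 0.

Definition step (k : nat) (om : T) (st : 'I_N -> 'cV[R]_n) : 'I_N -> 'cV[R]_n :=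
  fun i =>
    let xi := xval k (st i) in
    let check := st i + (\sum_(j < N | 0 < a i j)
         alpha i j k * a i j * (shat j i k (xval k (st j)) om - Gfun i j k xi)) *: phi k in
    let y := H i k *m theta + w i k om in
    check + beta i k *: ((H i k)^T *m (y - H i k *m st i)).

Fixpoint theta_hat (k : nat) (om : T) : 'I_N -> 'cV[R]_n :=
  match k with
  | 0 => theta0
  | k'.+1 => step k'.+1 om (theta_hat k' om)
  end.

Definition zeta (i j : 'I_N) (t : nat) (om : T) : R :=
  if Cthr i j t < `|xval t (theta_hat t.-1 om i) + b i j * dn i t om| then 1 else 0.

Definition n_ordered_edges : R := \sum_(i < N) \sum_(j < N | 0 < a i j) 1.

Definition Brate (k : nat) (om : T) : R :=
  (\sum_(i < N) \sum_(j < N | 0 < a i j) \sum_(1 <= t < k.+1) zeta i j t om)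
  / (k%:R * n_ordered_edges).

End AlgSC.

Definition laplacian {R : realType} {N : nat} (a : 'I_N -> 'I_N -> R) : 'M[R]_N :=
  diag_mx (\row_(i < N) \sum_(j < N | 0 < a i j) a i j) - \matrix_(i, j) a i j.

Section Filtrations.
Context {R : realType} {d : measure_display} {T : measurableType d}.
Variables (N : nat) (m : 'I_N -> nat).
Variable w : forall i : 'I_N, nat -> T -> 'cV[R]_(m i).
Variable dn : 'I_N -> nat -> T -> R.

Definition Gw (k : nat) : set (set T) :=
  [set A | exists (i : 'I_N) (t : nat) (r : 'I_(m i)), (1 <= t <= k)%N /\
     exists B : set R, measurable B /\ A = (fun om => w i t om r 0) @^-1` B].

Definition Gd (k : nat) : set (set T) :=
  [set A | exists (i : 'I_N) (t : nat), (1 <= t <= k)%N /\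
     exists B : set R, measurable B /\ A = dn i t @^-1` B].

Definition Fsig (k : nat) : set (set T) := <<s Gw k `|` Gd k >>.
Definition Fwsig (k : nat) : set (set T) := <<s Gw k >>.
Definition Fw_all : set (set T) := <<s [set A | exists k, Gw k A] >>.
Definition sig_d (i : 'I_N) (k : nat) : set (set T) :=
  <<s [set A | exists B : set R, measurable B /\ A = dn i k @^-1` B] >>.

End Filtrations.

(* z_k = min{alpha_{ij,k}/k^{nu_ij}, (i,j) in E; beta_{i,k}, i in V}
   (computed in \bar R so that the minimum over a finite family is total) *)
Definition zmin {R : realType} {N : nat} (a nu : 'I_N -> 'I_N -> R)
  (alpha : 'I_N -> 'I_N -> nat -> R) (beta : 'I_N -> nat -> R) (k : nat) : \bar R :=
  Order.min
    (\big[Order.min/+oo%E]_(i < N) \big[Order.min/+oo%E]_(j < N | 0 < a i j)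
        ((alpha i j k / (k%:R `^ nu i j))%:E))
    (\big[Order.min/+oo%E]_(i < N) (beta i k)%:E).

(* underline nu = min over E of nu_ij (finite whenever E is nonempty) *)
Definition nu_min {R : realType} {N : nat} (a nu : 'I_N -> 'I_N -> R) : R :=
  fine (\big[Order.min/+oo%E]_(i < N) \big[Order.min/+oo%E]_(j < N | 0 < a i j)
        ((nu i j)%:E)).

(* Main.v *)
Require Import Defs.
From HB Require Import structures.
From mathcomp Require Import all_boot all_order all_algebra.
From mathcomp Require Import all_classical all_reals all_analysis.
From mathcomp Require Import measurable_realfun.
From mathcomp Require Import ring lra.
Set Implicit Arguments. Unset Strict Implicit. Unset Printing Implicit Defensive.
Import Order.TTheory GRing.Theory Num.Theory.
Import numFieldNormedType.Exports.
Local Open Scope classical_set_scope.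
Local Open Scope ring_scope.

(** Only boundedness of the estimates is needed, not their convergence.  Let
    V_k be the sum over the sensors of |hat theta_{i,k} - theta|^2.  Given the
    past, the expected one-bit signal s_{ji,k} is G_{ji,k}(x_{j,k}), so by
    symmetry of the weights and monotonicity of G the consensus term does not
    increase V in mean, and neither does the innovation term; what remains is
    V_{k-1} times a constant times sum beta^2, plus terms of order alpha^2 and
    beta^2 |w|^2.  Hence V is an almost supermartingale with summable
    perturbations (on the events where the conditional moments of the noise are
    bounded by M), and a maximal inequality shows that it is almost surely
    bounded.  So |x_{i,k}| <= L for a random L, and then a bit sent at time t
    forces |d_{i,t}| > (C_t - L) / b, an event that is independent of the past
    and of probability q_t = O(t^-nu).  With eta_t its indicator, the product of
    the (1 + eta_t) / (1 + q_t) is a nonnegative supermartingale, hence bounded,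
    which gives sum_{t <= k} eta_t = O(1 + sum_{t <= k} q_t) = O(k^(1 - nu)).
    Finally nu < 1, since alpha_k / k is summable when alpha_k^2 is. *)

(** Conditional expectations are never formed: each conditional statement is a relation between
    integrals over the events of a sigma-algebra, and a factor known from the past is pulled out by
    a layer-cake formula. Three obstacles shape the rest. The energy is not known to be integrable
    in advance, so every estimate is made on an event of the past where V_k is at most some level
    lam; the maximal inequality asks for no other events. The moment bound is conditional on the
    past of w alone, whereas the events B at hand also involve the dithers; as |w|^2 is nonnegative,
    its integral over B is enlarged to one over an event of the past of w, so the perturbation
    enters as a constant, not multiplied by P(B). Finally, the bound L on the estimates depends on
    the whole path, and a large dither is independent of the past only when compared with a fixed
    level; the counts are therefore bounded almost surely for all natural L at once, and L is chosen
    path by path afterwards. *)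

(** * Maximal inequality for almost supermartingales *)

Section MaximalInequality.
Context {R : realType} {d : measure_display} {T : measurableType d}.
Variable P : probability T R.
Variable F : nat -> set (set T).
Hypothesis F_sigma : forall k, sigma_algebra setT (F k).
Hypothesis F_meas : forall k, F k `<=` measurable.
Hypothesis F_incr : forall k, F k `<=` F k.+1.

Lemma sigma_algebra_setI (G : set (set T)) (A B : set T) :
  sigma_algebra setT G -> G A -> G B -> G (A `&` B).
Proof.
move=> [G0 GC GU] GA GB; rewrite -(setCK (A `&` B)) setCI -(setTD (_ `|` _)).
have GC' X : G X -> G (~` X) by rewrite -setTD; exact: GC.
apply: GC; rewrite -bigcup2E; apply: GU => -[|[|k]] //=; exact: GC'.
Qed.

Lemma measurable_wrt_meas (G : set (set T)) (X : T -> R) :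
  G `<=` measurable -> measurable_wrt G X -> measurable_fun setT X.
Proof. by move=> GM GX _ B mB; rewrite setTI; apply/GM/GX. Qed.

(** Doob's argument: stop at the first passage above lam, or when some [A k] fails. The mass that
    passes above lam is then at most (v0 + K) / lam, which tends to 0. *)
Lemma almost_supermartingale_bounded
    (V : nat -> T -> R) (A : nat -> set T) (r : nat -> R) (v0 K : R) :
  (forall k om, 0 <= V k om) ->
  (forall k, measurable_wrt (F k) (V k)) ->
  (forall k, F k (A k)) ->
  (forall om, V 0%N om <= v0) ->
  (forall k, \sum_(j < k) r j <= K) ->
  (forall k lam B, F k B -> B `<=` A k -> (forall om, B om -> V k om <= lam) ->
    (\int[P]_(om in B) (V k.+1 om)%:E <=
      \int[P]_(om in B) (V k om)%:E + (r k)%:E)%E) ->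
  {ae P, forall om, (forall k, A k om) -> exists C, forall k, V k om <= C}.
Proof.
move=> V_ge0 V_meas A_meas V0 r_le hV.
(* [B lam k] is survival up to time k: all [A j] have held and V has stayed at most lam. [E lam k]
   below is the first passage above lam at time k + 1. *)
pose B lam := fix B k := if k is k'.+1
  then B k' `&` (A k'.+1 `&` [set om | V k'.+1 om <= lam])
  else A 0%N `&` [set om | V 0%N om <= lam].
have FV k lam : F k [set om | V k om <= lam].
  have -> : [set om | V k om <= lam] = V k @^-1` [set x | x <= lam] by [].
  by apply: V_meas; rewrite -set_itvNyc; exact: measurable_itv.
have FB lam k : F k (B lam k).
  elim: k => [|k IH] /=; first exact: sigma_algebra_setI.
  apply: sigma_algebra_setI => //; first exact: F_incr.
  exact: sigma_algebra_setI.
have BA lam k : B lam k `<=` A k by case: k => [|k] om /=; [case|case=> _ []].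
have BV lam k om : B lam k om -> V k om <= lam.
  by case: k => [|k] /=; [case|case=> _ []].
pose E lam k := B lam k `&` [set om | lam < V k.+1 om].
have mB lam k : measurable (B lam k) by apply: F_meas (FB lam k).
have mV k : measurable_fun setT (V k) by apply: measurable_wrt_meas (V_meas k).
have mVE k D : measurable_fun D (EFin \o V k).
  by apply/measurable_EFinP; apply: measurable_funS (mV k).
have mgt lam k : measurable [set om | lam < V k om].
  have -> : [set om | lam < V k om] = ~` [set om | V k om <= lam].
    by apply/seteqP; split => om /=; rewrite ltNge; [move/negP|move/negP].
  by apply: measurableC; apply: F_meas (FV k lam).
have mE lam k : measurable (E lam k) by apply: measurableI.
have key (lam : R) k : 0 < lam ->
  (\sum_(j < k) lam%:E * P (E lam j) + \int[P]_(om in B lam k) (V k om)%:E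
    <= (v0 + \sum_(j < k) r j)%:E)%E.
  move=> lam0; elim: k => [|k IH].
    rewrite !big_ord0 add0e addr0.
    apply: (@le_trans _ _ (\int[P]_(om in B lam 0%N) cst v0%:E om)%E).
      by apply: ge0_le_integral => //; try exact: mVE; move=> om _; rewrite lee_fin.
    rewrite integral_cst //.
    (* Follows from [V 0 >= 0] at any point of [T]; a point exists because [T] has mass 1. *)
    have v00 : 0 <= v0.
      have [om _] : exists om : T, True.
        apply: contrapT => h; have : P setT = 0.
          rewrite (_ : setT = set0) ?measure0 //.
          by apply/seteqP; split => om // _; case: h; exists om.
        by rewrite probability_setT => /eqP; rewrite onee_eq0.
      exact: le_trans (V0 om).
    by rewrite -[leRHS]mule1; apply: lee_pmul => //; exact: probability_le1.
  (* [E lam k] and [B lam k.+1] are disjoint parts of [B lam k]. The paths lost because [A k.+1]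
     fails are dropped, as V is nonnegative. *)
  have step : (lam%:E * P (E lam k) + \int[P]_(om in B lam k.+1) (V k.+1 om)%:E
     <= \int[P]_(om in B lam k) (V k.+1 om)%:E)%E.
    apply: (@le_trans _ _ (\int[P]_(om in E lam k) (V k.+1 om)%:E +
        \int[P]_(om in B lam k.+1) (V k.+1 om)%:E)%E).
      apply: leeD => //; rewrite -integral_cst //.
      apply: ge0_le_integral => //; try exact: mVE.
      - by move=> om _; rewrite lee_fin ltW.
      - by move=> om [_ /= h]; rewrite lee_fin ltW.
    rewrite -ge0_integral_setU //; last 3 first.
    - exact: mVE.
    - by move=> om _; rewrite lee_fin.
    - apply/disj_setPS => om [[hB h1] [hB' [hA h2]]].
      by move: (lt_le_trans h1 h2); rewrite ltxx.
    - apply: ge0_subset_integral => //.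
      + exact: measurableU.
      + exact: mVE.
      + by move=> om _; rewrite lee_fin.
      + by move=> om [[hB _]|[hB _]].
  move: step; set J := (\int[P]_(om in B lam k.+1) _)%E => step.
  rewrite 2!big_ord_recr /= -addeA (addrA v0) EFinD.
  apply: (le_trans (leeD2l _ step)).
  apply: (le_trans (leeD2l _ (hV k lam _ (FB lam k) (@BA lam k) (@BV lam k)))).
  by rewrite addeA; apply: leeD2r.
have PE (lam : R) : 0 < lam -> (lam%:E * P (\bigcup_k E lam k) <= (v0 + K)%:E)%E.
  move=> lam0.
  apply: (@le_trans _ _ (lam%:E * \sum_(0 <= k <oo) P (E lam k))%E).
    apply: lee_wpmul2l; first by rewrite lee_fin ltW.
    by apply: measure_sigma_subadditive => //; exact: bigcup_measurable.
  rewrite -nneseriesZl //; apply: lime_le.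
    by apply: is_cvg_nneseries => n _ _; rewrite mule_ge0 // lee_fin ltW.
  apply: nearW => n; rewrite big_mkord.
  apply: le_trans (_ : ((v0 + \sum_(j < n) r j)%:E <= _)%E); last first.
    by rewrite lee_fin lerD2l.
  apply: le_trans (key lam n lam0); apply: leeDl.
  by apply: integral_ge0 => om _; rewrite lee_fin.
(* The levels grow with n, are positive, and exceed v0, so that survival at time 0 is automatic. *)
pose bad := \bigcap_n \bigcup_k E (n%:R + `|v0| + 1) k.
have mbad : measurable bad.
  by apply: bigcap_measurable => // n _; exact: bigcup_measurable.
have K0 : 0 <= v0 + K.
  have := PE 1 ltr01; rewrite mul1e => h; rewrite -lee_fin; apply: le_trans h.
  exact: measure_ge0.
exists bad; split => //.
  apply/eqP; rewrite eq_le measure_ge0 andbT.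
  apply/lee_addgt0Pr => e e0; rewrite add0e.
  pose n := (Num.truncn ((v0 + K) / e)).+1.
  have hn : (v0 + K) / e < n%:R + `|v0| + 1.
    apply: lt_le_trans (_ : n%:R <= _); last by rewrite -addrA lerDl addr_ge0.
    exact: truncnS_gt.
  have l0 : 0 < n%:R + `|v0| + 1.
    by apply: le_lt_trans hn; rewrite divr_ge0 // ltW.
  apply: (@le_trans _ _ (P (\bigcup_k E (n%:R + `|v0| + 1) k))).
    apply: le_measure; rewrite ?inE //; first exact: bigcup_measurable.
    by move=> om; apply.
  have := PE _ l0.
  have : (P (\bigcup_k E (n%:R + `|v0| + 1) k)) \is a fin_num.
    by apply: fin_num_measure; exact: bigcup_measurable.
  move=> /fineK <-; rewrite -EFinM !lee_fin => h.
  rewrite -(ler_pM2l l0) (le_trans h) //.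
  by rewrite -ler_pdivrMr // ltW.
move=> om /= nQ n _.
apply: contrapT => hE; apply: nQ => hA; exists (n%:R + `|v0| + 1) => k.
suff: B (n%:R + `|v0| + 1) k om by exact: BV.
elim: k => [|k IH] /=.
  split; [exact: hA|]; rewrite /= (le_trans (V0 om)) // (le_trans (ler_norm _)) //.
  by rewrite -addrA addrCA lerDl addr_ge0.
split=> //; split; first exact: hA.
rewrite /= leNgt; apply/negP => h; apply: hE; exists k => //.
Qed.

End MaximalInequality.

(** * Pulling a factor measurable for the past out of an integral *)

Section LayerCake.
Context {R : realType} {d : measure_display} {T : measurableType d}.
Variable P : probability T R.

(** Tonelli for f(om) times the indicator of 0 <= y < g(om). It reduces a weighted integral of f to
    integrals over level sets of g. *)
Lemma integral_layer_cake (g : T -> R) (f : T -> \bar R) :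
  (forall om, 0 <= g om) -> measurable_fun setT g ->
  (forall om, (0 <= f om)%E) -> measurable_fun setT f ->
  (\int[P]_om (f om * (g om)%:E) =
   \int[lebesgue_measure]_y
     \int[P]_(om in [set om | (0 <= y)%R /\ (y < g om)%R]) f om)%E.
Proof.
move=> g0 mg f0 mf.
pose h (z : T * R) := (f z.1 *
  (if (0 <= z.2)%R && (z.2 < g z.1)%R then 1 else 0)%:E)%E.
have mh : measurable_fun setT h.
  apply: emeasurable_funM; first exact: measurableT_comp.
  apply/measurable_EFinP; apply: measurable_fun_ifT => //.
  apply: measurable_and.
    by apply: measurable_fun_ler => //; exact: measurable_snd.
  apply: measurable_fun_ltr; first exact: measurable_snd.
  by apply: measurableT_comp => //.
have h0 z : (0 <= h z)%E by rewrite /h; case: ifP => _; rewrite mule_ge0.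
have := @fubini_tonelli _ _ _ _ _ P lebesgue_measure h mh h0.
move=> fub; transitivity (\int[P]_x \int[lebesgue_measure]_y h (x, y))%E.
  apply: eq_integral => om _; rewrite /h /=.
  have -> : (fun y : R => f om *
      (if (0 <= y)%R && (y < g om)%R then 1 else 0)%:E)%E =
      (fun y => f om * (\1_(`[0, g om[%classic : set R) y)%:E)%E.
    apply/funext => y; rewrite indicE; congr (_ * _%:E)%E.
    case: ifPn => yg; first by rewrite mem_set //= in_itv.
    by rewrite memNset //= in_itv /=; exact/negP.
  rewrite ge0_integralZl //; last first.
    by apply/measurable_EFinP; exact: measurable_indic.
  rewrite integral_indic // setIT; congr (_ * _)%E; apply/esym.
  have := lebesgue_measure_itv `[0, g om[ => /= ->; rewrite lte_fin.
  by case: ltgtP (g0 om) => // [_ _|<- _]; rewrite ?sube0.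
rewrite fub; apply: eq_integral => y _.
rewrite [RHS]integral_mkcond; apply: eq_integral => om _.
rewrite patchE /h /=; case: ifPn => [/andP[y0 yg]|yg].
  by rewrite mem_set ?mule1.
rewrite memNset ?mule0 // => -[y0 yg']; move: yg; by rewrite y0 yg'.
Qed.


(** The level sets of g belong to G (they are empty for y < 0), so by the layer cake two functions
    with equal integrals on G have equal integrals against every nonnegative G-measurable weight. *)
Lemma integral_mul_eq (G : set (set T)) (f1 f2 : T -> \bar R) (g : T -> R) :
  sigma_algebra setT G -> G `<=` measurable ->
  (forall om, (0 <= f1 om)%E) -> measurable_fun setT f1 ->
  (forall om, (0 <= f2 om)%E) -> measurable_fun setT f2 ->
  (forall A, G A -> \int[P]_(om in A) f1 om = \int[P]_(om in A) f2 om)%E ->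
  (forall om, 0 <= g om) -> measurable_wrt G g ->
  (\int[P]_om (f1 om * (g om)%:E) = \int[P]_om (f2 om * (g om)%:E))%E.
Proof.
move=> Gs Gm f10 mf1 f20 mf2 f12 g0 mg.
have mg' : measurable_fun setT g by exact: measurable_wrt_meas mg.
rewrite !integral_layer_cake //; apply: eq_integral => y _; apply: f12.
have [y0|y0] := boolP (0 <= y).
  rewrite [X in G X](_ : _ = g @^-1` [set x | (y : R) < x]); last first.
    by apply/seteqP; split => om /= => [[]|].
  by apply: mg; rewrite -set_itvoy; exact: measurable_itv.
rewrite [X in G X](_ : _ = set0); last first.
  by apply/seteqP; split => om //= -[h _].
by case: Gs.
Qed.
End LayerCake.

(** * Integrating out a variable independent of the past *)

Section Independence.
Context {R : realType} {d : measure_display} {T : measurableType d}.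
Variable P : probability T R.
Variables (G : set (set T)) (X : T -> R).
Hypothesis G_meas : <<s G >> `<=` measurable.
Hypothesis X_meas : measurable_fun setT X.
Hypothesis G_indep_X : forall A B, <<s G >> A -> measurable B ->
  P (A `&` X @^-1` B) = (P A * P (X @^-1` B))%E.

(** Read the identity as a map into [T] equipped with the sigma-algebra generated by G. Independence
    says that the law of the pair (identity, X) is the product law, and Tonelli applies. *)
Lemma integral_indep (h : g_sigma_algebraType G * R -> \bar R) :
  measurable_fun setT h -> (forall z, (0 <= h z)%E) ->
  (\int[P]_om h (om, X om) = \int[P]_om \int[P]_om' h (om, X om'))%E.
Proof.
move=> mh h0.
pose S := g_sigma_algebraType G.
have mid : measurable_fun setT (id : T -> S).
  by move=> _ A mA; rewrite setTI; exact: G_meas.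
have mpair : measurable_fun setT ((fun om => (om, X om)) : T -> S * R).
  by apply/measurable_fun_pairP; split.
pose idS : {mfun T >-> S} := mfun_Sub (mem_set mid).
pose XS : {mfun T >-> R} := mfun_Sub (mem_set X_meas).
pose pS : {mfun T >-> (S * R)%type} := mfun_Sub (mem_set mpair).
have prodE : forall A, measurable A ->
   (distribution P idS \x distribution P XS)%E A = distribution P pS A.
  apply: product_measure_unique => A B mA mB; exact: G_indep_X.
have -> : (\int[P]_om h (om, X om) = \int[distribution P pS]_z h z)%E.
  by rewrite ge0_integral_distribution.
rewrite -(@eq_measure_integral _ _ _ _ (distribution P pS) (distribution P idS \x distribution P XS)%E); last first.
  by move=> A mA _; exact: prodE.
rewrite fubini_tonelli1 // ge0_integral_distribution.
- apply: eq_integral => om _ /=; rewrite /fubini_F.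
  rewrite ge0_integral_distribution //.
  exact: measurableT_comp.
- exact: measurable_fun_fubini_tonelli_F.
- by move=> y; apply: integral_ge0.
Qed.
End Independence.

(** * Almost supermartingales with multiplicative growth *)

Section Bounded.
Context {R : realType} {d : measure_display} {T : measurableType d}.
Variable P : probability T R.

(** Dividing V_k by the product of the 1 + c_j, j < k, removes the growth factor. These products are
    at least 1, so the r_k do not increase, and at most exp(Kc), so a bound on the quotient is a
    bound on V. *)
Lemma robbins_siegmund_bounded (F : nat -> set (set T))
    (V : nat -> T -> R) (A : nat -> set T) (c r : nat -> R) (v0 Kc K : R) :
  (forall k, sigma_algebra setT (F k)) -> (forall k, F k `<=` measurable) ->
  (forall k, F k `<=` F k.+1) ->
  (forall k om, 0 <= V k om) -> (forall k, measurable_wrt (F k) (V k)) ->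
  (forall k, F k (A k)) -> (forall om, V 0%N om <= v0) ->
  (forall k, 0 <= c k) -> (forall k, 0 <= r k) ->
  (forall k, \sum_(j < k) c j <= Kc) -> (forall k, \sum_(j < k) r j <= K) ->
  (forall k lam B, F k B -> B `<=` A k -> (forall om, B om -> V k om <= lam) ->
    (\int[P]_(om in B) (V k.+1 om)%:E <=
      (1 + c k)%:E * \int[P]_(om in B) (V k om)%:E + (r k)%:E)%E) ->
  {ae P, forall om, (forall k, A k om) -> exists C, forall k, V k om <= C}.
Proof.
move=> Fs Fm Fi V0 mV FA hv0 c0 r0 cK rK hV.
pose Pi k := \prod_(j < k) (1 + c j).
have Pi_ge1 k : 1 <= Pi k.
  elim: k => [|k IH]; first by rewrite /Pi big_ord0.
  rewrite /Pi big_ord_recr /= -[leLHS]mulr1; apply: ler_pM => //.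
  by rewrite lerDl.
have Pi_gt0 k : 0 < Pi k by exact: lt_le_trans (Pi_ge1 k).
have Pi_le k : Pi k <= expR Kc.
  apply: le_trans (_ : expR (\sum_(j < k) c j) <= _); last by rewrite ler_expR.
  rewrite expR_sum; apply: ler_prod => j _; rewrite addr_ge0 //=.
  exact: expR_ge1Dx.
have mVT k : measurable_fun setT (V k) by exact: measurable_wrt_meas (mV k).
have intZ k j B : measurable B ->
    (\int[P]_(om in B) (V k om / Pi j)%:E =
     (Pi j)^-1%:E * \int[P]_(om in B) (V k om)%:E)%E.
  move=> mB; rewrite -ge0_integralZl //.
  - by apply: eq_integral => om _; rewrite mulrC EFinM.
  - by apply/measurable_EFinP; apply: measurable_funS (mVT k).
  - by move=> om _; rewrite lee_fin.
  - by rewrite lee_fin invr_ge0 ltW.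
suff : {ae P, forall om, (forall k, A k om) ->
    exists C, forall k, V k om / Pi k <= C}.
  apply: filterS => om h /h[C hC]; exists (`|C| * expR Kc) => k.
  have := hC k; rewrite ler_pdivrMr // => /le_trans; apply.
  apply: (@le_trans _ _ (`|C| * Pi k)); first by rewrite ler_pM2r // ler_norm.
  by rewrite ler_wpM2l.
apply: (@almost_supermartingale_bounded _ _ _ P F Fs Fm Fi _ A r v0 K) => //.
- by move=> k om; rewrite divr_ge0 // ltW.
- move=> k B mB.
  have -> : (fun om => V k om / Pi k) @^-1` B =
      V k @^-1` ((fun x => x / Pi k) @^-1` B) by [].
  apply: mV; rewrite -[X in measurable X]setTI.
  by apply: (@mulrr_measurable _ _ ((Pi k)^-1)).
- by move=> om; rewrite /Pi big_ord0 divr1.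
move=> k lam B FB BA Blam.
have mB : measurable B by exact: Fm FB.
rewrite !intZ //.
have hB : forall om, B om -> V k om <= lam * Pi k.
  by move=> om /Blam; rewrite ler_pdivrMr.
have h := hV k _ B FB BA hB.
apply: (le_trans (lee_wpmul2l _ h)); first by rewrite lee_fin invr_ge0 ltW.
have I0 : (0 <= \int[P]_(om in B) (V k om)%:E)%E.
  by apply: integral_ge0 => om _; rewrite lee_fin.
rewrite muleDr ?ge0_adde_def ?inE ?mule_ge0 ?lee_fin ?addr_ge0 //.
rewrite muleA -EFinM; apply: leeD.
  rewrite (_ : (Pi k.+1)^-1 * (1 + c k) = (Pi k)^-1) //.
  rewrite {1}/Pi big_ord_recr /= -/(Pi k) invfM -mulrA mulVf ?mulr1 //.
  by rewrite gt_eqF // ltr_wpDr.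
rewrite -EFinM lee_fin ler_pdivrMl // -{1}[r k]mul1r; apply: ler_wpM2r => //.
Qed.
End Bounded.

(** * From mutual independence to independence of a finite join *)

Section MutualIndependence.
Context {R : realType} {d : measure_display} {T : measurableType d}.
Variable P : probability T R.
Variables (I : eqType) (F : I -> set (set T)).
Hypothesis F_sigma : forall i, sigma_algebra setT (F i).
Hypothesis F_meas : forall i, F i `<=` measurable.
Hypothesis F_indep : mutually_independent P F.

(** Intersections of one event from each F_j, j in J, form a pi-system generating the join. On it
    the finite measures P(. [&] E) and P(E) P(.) agree, hence they agree on the generated
    sigma-algebra. *)
Lemma mutually_independent_join (J : seq I) (i : I) (A E : set T) :
  uniq (i :: J) -> <<s [set A | exists2 j, j \in J & F j A] >> A -> F i E ->
  P (A `&` E) = (P A * P E)%E.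
Proof.
move=> /= /andP[iJ uJ] sA FE.
pose cap (A : I -> set T) := \bigcap_(j in [set j | j \in J]) A j.
pose PS := [set X | exists2 A : I -> set T,
  (forall j, j \in J -> F j (A j)) & X = cap A].
have FT j : F j setT.
  by case: (F_sigma j) => F0 FC _; rewrite -(setD0 setT); exact: FC.
have mcap A' : (forall j, j \in J -> F j (A' j)) -> measurable (cap A').
  move=> FA; apply: fin_bigcap_measurable => [|j jJ]; last exact/F_meas/FA.
  exact: finite_seq.
have PSm : PS `<=` measurable by move=> _ [A' FA ->]; exact: mcap.
have PST : PS setT by exists (fun=> setT) => //; apply/seteqP; split.
have PSI : setI_closed PS.
  move=> _ _ [A1 FA1 ->] [A2 FA2 ->]; exists (fun j => A1 j `&` A2 j).
    by move=> j jJ; apply: sigma_algebra_setI; [exact: F_sigma|exact: FA1|exact: FA2].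
  by rewrite /cap bigcapI.
have mE : measurable E by exact: F_meas FE.
have PE0 : 0 <= fine (P E) by exact: fine_ge0.
have sPS : <<s [set A | exists2 j, j \in J & F j A] >> `<=` <<s PS >>.
  apply: sub_sigma_algebra2 => X [j jJ FX]; exists (fun j' => if j' == j then X else setT).
    by move=> j' _; case: ifP => [/eqP ->|].
  apply/seteqP; split => om /=.
    by move=> Xom j' _; case: ifP.
  by move=> /(_ j jJ); rewrite eqxx.
have PSE : forall X, PS X -> mrestr P mE X = mscale (NngNum PE0) P X.
  move=> _ [A' FA ->].
  rewrite /mrestr /mscale /=.
  (* E becomes the event of the extra index i, so that independence over [i :: J] applies. *)
  pose A'' j := if j == i then E else A' j.
  have capE : cap A' `&` E = \bigcap_(j in [set j | j \in i :: J]) A'' j.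
    apply/seteqP; split => om /=.
      move=> [h1 h2] j; rewrite /= inE /A''; case: eqP => //= _; exact: h1.
    move=> h; split; last by have := h i; rewrite /= inE eqxx /A'' eqxx; exact.
    move=> j jJ; have := h j; rewrite /= inE jJ orbT /A''; case: eqP => [jE|_]; last exact.
    by move: iJ; rewrite -jE jJ.
  have h1 := @F_indep (i :: J) _ A'' _.
  have h2 := @F_indep J uJ A' FA.
  have -> : P (cap A' `&` E) = (fine (P (cap A' `&` E)))%:E.
    by rewrite fineK // fin_num_measure //; apply: measurableI => //; exact: mcap.
  rewrite capE h1 /=; last 2 first.
  - by rewrite iJ.
  - move=> j; rewrite inE /A''; case: eqP => [-> //|_ /=]; exact: FA.
  rewrite big_cons {1}/A'' eqxx EFinM.
  have -> : P (cap A') = (fine (P (cap A')))%:E.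
    by rewrite fineK // fin_num_measure //; exact: mcap.
  rewrite h2; congr (_ * _%:E)%E; apply: eq_big_seq => j jJ; rewrite /A''.
  by case: eqP => // jE; move: iJ; rewrite -jE jJ.
have cov : \bigcup_(k : nat) (setT : set T) = setT.
  by apply/seteqP; split => // om _; exists 0%N.
have fin (k : nat) : (mrestr P mE setT < +oo)%E.
  rewrite /mrestr setTI; apply: le_lt_trans (probability_le1 P mE) _; exact: ltry.
have := @g_sigma_algebra_measure_unique _ _ _ PS PSm (fun=> setT) (fun=> PST)
  cov (mrestr P mE) (mscale (NngNum PE0) P) PSI PSE fin A (sPS _ sA).
rewrite -[LHS]/(P (A `&` E)) => ->.
rewrite -[LHS]/((fine (P E))%:E * P A)%E.
by rewrite fineK ?fin_num_measure // muleC.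
Qed.
End MutualIndependence.

(** * The Laplace law *)

Section Laplace.
Context {R : realType}.
Implicit Types x y : R.

Lemma laplace_cdfN x : laplace_cdf (- x) = 1 - laplace_cdf x.
Proof.
rewrite /laplace_cdf oppr_lt0 opprK; case: (ltgtP x 0) => [x0|x0|->].
- by [].
- by ring.
- by rewrite oppr0 expR0; field.
Qed.

Lemma laplace_cdf_ge0 x : 0 <= laplace_cdf x.
Proof.
rewrite /laplace_cdf; case: ifPn => [_|]; first by rewrite divr_ge0 ?expR_ge0.
rewrite -leNgt => x0; have : expR (- x) <= 1 by rewrite -expR0 ler_expR oppr_le0.
lra.
Qed.

Lemma laplace_cdf_le1 x : laplace_cdf x <= 1.
Proof. by have := laplace_cdf_ge0 (- x); rewrite laplace_cdfN subr_ge0. Qed.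

Lemma expR_lip x y : x <= y -> y <= 0 -> expR y - expR x <= y - x.
Proof.
move=> xy y0; have -> : expR y - expR x = expR y * (1 - expR (x - y)).
  by rewrite mulrBr mulr1 -expRD addrCA subrr addr0.
have h1 : 1 + (x - y) <= expR (x - y) by exact: expR_ge1Dx.
have h2 : expR y <= 1 by rewrite -expR0 ler_expR.
have h3 := expR_gt0 y.
apply: (@le_trans _ _ (expR y * (y - x))).
  by rewrite ler_pM2l //; lra.
by rewrite -[leRHS]mul1r ler_wpM2r // subr_ge0.
Qed.

Lemma le_laplace_cdf x y : x <= y -> laplace_cdf x <= laplace_cdf y.
Proof.
move=> xy; rewrite /laplace_cdf; case: ifPn => [x0|]; case: ifPn => [y0|].
- by rewrite ler_pM2r // ler_expR.
- rewrite -leNgt => y0.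
  have : expR (- y) <= 1 by rewrite -expR0 ler_expR oppr_le0.
  have : expR x <= 1 by rewrite -expR0 ler_expR ltW.
  by lra.
- by rewrite -leNgt => x0; move: (le_lt_trans (le_trans x0 xy) y0); rewrite ltxx.
- by move=> _ _; rewrite lerD2l lerN2 ler_pM2r // ler_expR lerN2.
Qed.

(** Serves to show that a Laplace variable has no atom, which the strict inequality in [laplace_lt]
    requires. *)
Lemma laplace_cdf_lip x y : x <= y -> laplace_cdf y - laplace_cdf x <= y - x.
Proof.
move=> xy; rewrite /laplace_cdf; case: ifPn => [y0|]; case: ifPn => [x0|].
- have := expR_lip xy (ltW y0); rewrite -mulrBl; lra.
- by rewrite -leNgt => x0; move: (le_lt_trans (le_trans x0 xy) y0); rewrite ltxx.
- rewrite -leNgt => y0.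
  have := expR_ge1Dx x; have := expR_ge1Dx (- y); lra.
- rewrite -!leNgt => x0 y0.
  have h1 : - y <= - x by rewrite lerN2.
  have h2 : - x <= 0 by rewrite oppr_le0.
  have := expR_lip h1 h2; lra.
Qed.

Lemma measurable_laplace_cdf : measurable_fun setT (@laplace_cdf R).
Proof.
apply: measurable_fun_ifT.
- exact: measurable_fun_ltr.
- by apply: measurable_funM => //; exact: measurable_expR.
- apply: measurable_funB => //; apply: measurable_funM => //.
  by apply: measurableT_comp; [exact: measurable_expR|exact: oppr_measurable].
Qed.

Context {d : measure_display} {T : measurableType d}.
Variables (P : probability T R) (X : T -> R).
Hypothesis X_meas : measurable_fun setT X.
Hypothesis X_lap : forall x, P [set om | X om <= x] = (laplace_cdf x)%:E.

Lemma laplace_gt x : P [set om | x < X om] = (1 - laplace_cdf x)%:E.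
Proof.
have mle : measurable [set om | X om <= x].
  by rewrite -[X in measurable X]setTI; exact: measurable_fun_le.
have -> : [set om | x < X om] = ~` [set om | X om <= x].
  by apply/seteqP; split => om /=; rewrite ltNge => /negP.
by rewrite probability_setC // X_lap.
Qed.

Lemma laplace_lt x : P [set om | X om < x] = (laplace_cdf x)%:E.
Proof.
have mlt : measurable [set om | X om < x].
  have -> : [set om | X om < x] = X @^-1` [set y | y < x] by [].
  by rewrite -set_itvNyo -[X in measurable X]setTI; exact: X_meas.
have mle y : measurable [set om | X om <= y].
  by rewrite -[X in measurable X]setTI; exact: measurable_fun_le.
apply/eqP; rewrite eq_le; apply/andP; split.
  by rewrite -X_lap; apply: le_measure; rewrite ?inE // => om /= /ltW.
apply/lee_addgt0Pr => e e0.
apply: (@le_trans _ _ (P [set om | (X om <= x - e)%R] + e%:E)%E).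
  rewrite X_lap -EFinD lee_fin.
  have := @laplace_cdf_lip (x - e) x; rewrite lerBlDr lerDl (ltW e0) => /(_ isT).
  by rewrite opprD opprK; lra.
apply: leeD2r; apply: le_measure; rewrite ?inE // => om /= h.
by apply: le_lt_trans h _; rewrite ltrBlDr ltrDl.
Qed.

End Laplace.

(** * Integrable functions of mean zero *)

Section Centered.
Context {R : realType} {d : measure_display} {T : measurableType d}.
Variable P : probability T R.

(** Integrability is included so that finite linear combinations stay centered. *)
Definition centered (f : T -> R) : Prop :=
  P.-integrable setT (EFin \o f) /\ (\int[P]_om (f om)%:E = 0)%E.

Lemma eq_centered (f g : T -> R) : f =1 g -> centered f -> centered g.
Proof. by move=> /funext ->. Qed.

Lemma centeredD (f g : T -> R) :
  centered f -> centered g -> centered (fun om => f om + g om).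
Proof.
move=> [If f0] [Ig g0]; split.
  have -> : EFin \o (fun om => f om + g om) = (EFin \o f) \+ (EFin \o g) by [].
  exact: integrableD.
under eq_integral do rewrite EFinD.
by rewrite integralD // f0 g0 adde0.
Qed.

Lemma centeredZ (c : R) (f : T -> R) :
  centered f -> centered (fun om => c * f om).
Proof.
move=> [If f0]; split.
  have -> : EFin \o (fun om => c * f om) = (fun om => c%:E * (EFin \o f) om)%E by [].
  exact: integrableZl.
under eq_integral do rewrite EFinM.
by rewrite integralZl // f0 mule0.
Qed.

Lemma centered_sum (I : Type) (s : seq I) (Q : pred I) (f : I -> T -> R) :
  (forall i, Q i -> centered (f i)) ->
  centered (fun om => \sum_(i <- s | Q i) f i om).
Proof.
move=> cf; elim: s => [|i s IH].
  apply: (@eq_centered (cst 0)); first by move=> om; rewrite big_nil.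
  by split; [exact: integrable0|exact: integral0].
case Qi : (Q i); last first.
  by apply: eq_centered IH => om; rewrite big_cons Qi.
by apply: eq_centered (centeredD (cf i Qi) IH) => om; rewrite big_cons Qi.
Qed.

Lemma bounded_integrable (f : T -> R) (M : R) :
  measurable_fun setT f -> (forall om, `|f om| <= M) ->
  P.-integrable setT (EFin \o f).
Proof.
move=> mf fM; apply: (@le_integrable _ _ _ P setT _ _ (EFin \o cst M)) => //.
- exact/measurable_EFinP.
- by move=> om _ /=; rewrite lee_fin (le_trans (fM om)) // ler_norm.
- exact: finite_measure_integrable_cst.
Qed.

Lemma centered_mulB (g a b : T -> R) (M K : R) :
  measurable_fun setT g -> measurable_fun setT a -> measurable_fun setT b ->
  (forall om, `|g om| <= M) -> (forall om, `|a om| <= K) ->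
  (forall om, `|b om| <= K) ->
  (\int[P]_om (g om * a om)%:E = \int[P]_om (g om * b om)%:E)%E ->
  centered (fun om => g om * (a om - b om)).
Proof.
move=> mg ma mb gM aK bK gab.
have Ia : P.-integrable setT (EFin \o (fun om => g om * a om)).
  apply: (@bounded_integrable _ (M * K)); first exact: measurable_funM.
  by move=> om; rewrite normrM; apply: ler_pM.
have Ib : P.-integrable setT (EFin \o (fun om => g om * b om)).
  apply: (@bounded_integrable _ (M * K)); first exact: measurable_funM.
  by move=> om; rewrite normrM; apply: ler_pM.
have E : EFin \o (fun om => g om * (a om - b om)) =
    ((EFin \o (fun om => g om * a om)%R) \- (EFin \o (fun om => g om * b om)%R))%E.
  by apply/funext => om /=; rewrite mulrBr EFinB.
split; first by rewrite E; exact: integrableB.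
rewrite -[LHS]/(\int[P]_om (EFin \o (fun om => g om * (a om - b om))%R) om)%E E.
rewrite integralB //= gab subee //.
exact: integrable_fin_num.
Qed.

(** The pull-out lemmas need nonnegative weights. A weight bounded by M in absolute value becomes
    one after adding M, and the correction M * phi is itself centered. *)
Lemma centered_shift (g phi : T -> R) (M : R) :
  centered (fun om => (g om + M) * phi om) -> centered phi ->
  centered (fun om => g om * phi om).
Proof.
move=> c1 c2; apply: eq_centered (centeredD c1 (centeredZ (- M) c2)) => om.
ring.
Qed.

(** The positive and negative parts of w have equal integrals on every event of G, so
    [integral_mul_eq] equates their integrals against the shifted weight. *)
Lemma centered_mds (G : set (set T)) (g w : T -> R) (M : R) :
  sigma_algebra setT G -> G `<=` measurable ->
  measurable_wrt G g -> (forall om, `|g om| <= M) ->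
  measurable_fun setT w -> cond_exp_zero P G w ->
  centered (fun om => g om * w om).
Proof.
move=> Gs Gm mg gM mw [Iw w0].
have GT : G setT by case: Gs => G0 GC _; rewrite -(setD0 setT); exact: GC.
apply: (@centered_shift _ _ M); last by split => //; exact: w0.
have mgT : measurable_fun setT g by exact: measurable_wrt_meas mg.
have gM0 om : 0 <= g om + M by have := gM om; rewrite ler_norml; lra.
have M0 : 0 <= M by have := gM point; exact: le_trans.
have IwM : P.-integrable setT (EFin \o (fun om => (g om + M) * w om)).
  apply: (@le_integrable _ _ _ P setT _ _ (fun om => (2 * M)%:E * (EFin \o w) om)%E) => //.
  - by apply/measurable_EFinP; apply: measurable_funM => //; exact: measurable_funD.
  - move=> om _ /=; rewrite lee_fin !normrM ler_wpM2r //.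
    by rewrite !ger0_norm // ?mulr_ge0 //; have := gM om; rewrite ler_norml; lra.
  - exact: integrableZl.
split => //; rewrite integralE.
have fp : (fun om => ((g om + M) * w om)%:E)^\+%E =
    (fun om => (EFin \o w)^\+ om * (g om + M)%:E)%E.
  apply/funext => om; rewrite !funeposE muleC maxe_pMr ?lee_fin // mule0.
  by rewrite EFinM.
have fn : (fun om => ((g om + M) * w om)%:E)^\-%E =
    (fun om => (EFin \o w)^\- om * (g om + M)%:E)%E.
  apply/funext => om; rewrite !funenegE muleC maxe_pMr ?lee_fin // mule0.
  by rewrite EFinM muleN.
have E : (\int[P]_om ((EFin \o w)^\+ om * (g om + M)%:E) =
          \int[P]_om ((EFin \o w)^\- om * (g om + M)%:E))%E.
  apply: (integral_mul_eq Gs Gm) => //.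
  - by apply: measurable_funepos; exact/measurable_EFinP.
  - by apply: measurable_funeneg; exact/measurable_EFinP.
  - move=> A GA; have := w0 A GA; rewrite integralE => /eqP.
    have mA := Gm _ GA.
    have IwA : P.-integrable A (EFin \o w) by exact: integrableS Iw.
    rewrite sube_eq ?add0e; first by move/eqP.
      exact: integrable_pos_fin_num.
    by rewrite fin_num_adde_defl // integrable_neg_fin_num.
  - move=> B mB.
    have -> : (fun om => g om + M) @^-1` B = g @^-1` ((fun x => x + M) @^-1` B) by [].
    apply: mg; rewrite -[X in measurable X]setTI.
    have : measurable_fun setT (fun x : R => x + M) by exact: measurable_funD.
    exact.
rewrite fp fn E subee //.
rewrite -fn; apply: integrable_neg_fin_num => //.
Qed.

End Centered.

Lemma measurable_fun_b2r (R : realType) (d : measure_display)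
    (T : measurableType d) (f : T -> bool) :
  measurable_fun setT f -> measurable_fun setT (fun x => (f x)%:R : R).
Proof.
move=> mf; rewrite (_ : (fun x => _) = (fun x => if f x then 1 else 0)).
  exact: measurable_fun_ifT.
by apply/funext => x; case: (f x).
Qed.

(** * Conditional mean of the one-bit signal *)

Section Signal.
Context {R : realType} {d : measure_display} {T : measurableType d}.
Variable P : probability T R.
Variables (G : set (set T)) (X : T -> R).
Hypothesis G_meas : <<s G >> `<=` measurable.
Hypothesis X_meas : measurable_fun setT X.
Hypothesis X_lap : forall x, P [set om | X om <= x] = (laplace_cdf x)%:E.
Hypothesis G_indep_X : forall A B, <<s G >> A -> measurable B ->
  P (A `&` X @^-1` B) = (P A * P (X @^-1` B))%E.

Local Notation S := (g_sigma_algebraType G).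

Lemma g_sigma_measurable_fun (f : T -> R) :
  measurable_fun [set: S] f -> measurable_fun setT f.
Proof. by move=> mf _ B mB; apply: G_meas; exact: mf. Qed.

(** The threshold u is random but known from the past; with the past frozen, X is integrated out by
    its tail. *)
Lemma integral_indep_gt (g u : T -> R) :
  measurable_fun [set: S] g -> measurable_fun [set: S] u ->
  (forall om, 0 <= g om) ->
  (\int[P]_om (g om * (u om < X om)%R%:R)%:E =
   \int[P]_om (g om * (1 - laplace_cdf (u om)))%:E)%E.
Proof.
move=> mg mu g0.
rewrite (@integral_indep _ _ _ P G X G_meas X_meas G_indep_X
  (fun z => (g z.1 * (u z.1 < z.2)%R%:R)%:E)).
- apply: eq_integral => om _ /=.
  under eq_integral do rewrite EFinM.
  rewrite ge0_integralZl ?lee_fin //; last first.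
    apply/measurable_EFinP; apply: measurable_fun_b2r.
    exact: measurable_fun_ltr.
  rewrite EFinM; congr (_ * _)%E; rewrite -(laplace_gt X_meas X_lap).
  have mset : measurable [set om' | u om < X om'].
    have -> : [set om' | u om < X om'] = X @^-1` [set y | u om < y] by [].
    by rewrite -set_itvoy -[X in measurable X]setTI; exact: X_meas.
  rewrite -[in RHS](setIT [set om' | _]) -integral_indic //.
  by apply: eq_integral => om' _; rewrite indicE mem_setE.
- apply/measurable_EFinP; apply: measurable_funM.
    exact: (measurableT_comp mg measurable_fst).
  apply: measurable_fun_b2r.
  apply: measurable_fun_ltr; last exact: measurable_snd.
  exact: (measurableT_comp mu measurable_fst).
- by move=> z; rewrite lee_fin mulr_ge0.
Qed.

Lemma integral_indep_lt (g u : T -> R) :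
  measurable_fun [set: S] g -> measurable_fun [set: S] u ->
  (forall om, 0 <= g om) ->
  (\int[P]_om (g om * (X om < u om)%R%:R)%:E =
   \int[P]_om (g om * laplace_cdf (u om))%:E)%E.
Proof.
move=> mg mu g0.
rewrite (@integral_indep _ _ _ P G X G_meas X_meas G_indep_X
  (fun z => (g z.1 * (z.2 < u z.1)%R%:R)%:E)).
- apply: eq_integral => om _ /=.
  under eq_integral do rewrite EFinM.
  rewrite ge0_integralZl ?lee_fin //; last first.
    apply/measurable_EFinP; apply: measurable_fun_b2r.
    exact: measurable_fun_ltr.
  rewrite EFinM; congr (_ * _)%E; rewrite -(laplace_lt X_meas X_lap).
  have mset : measurable [set om' | X om' < u om].
    have -> : [set om' | X om' < u om] = X @^-1` [set y | y < u om] by [].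
    by rewrite -set_itvNyo -[X in measurable X]setTI; exact: X_meas.
  rewrite -[in RHS](setIT [set om' | _]) -integral_indic //.
  by apply: eq_integral => om' _; rewrite indicE mem_setE.
- apply/measurable_EFinP; apply: measurable_funM.
    exact: (measurableT_comp mg measurable_fst).
  apply: measurable_fun_b2r.
  apply: measurable_fun_ltr; first exact: measurable_snd.
  exact: (measurableT_comp mu measurable_fst).
- by move=> z; rewrite lee_fin mulr_ge0.
Qed.

(** The signal is the indicator of u1 < X minus that of X < u2, with u1 = (c - x) / b and u2 = (- x
    - c) / b; c >= 0 makes the two events exclusive. By symmetry of the law their conditional
    probabilities are exactly the two terms of G. *)
Lemma centered_signal (g x : T -> R) (M c b : R) :
  measurable_fun [set: S] g -> measurable_fun [set: S] x ->
  (forall om, `|g om| <= M) -> 0 <= c -> 0 < b ->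
  centered P (fun om => g om *
    ((let v := x om + b * X om in
      if c < `|v| then (if 0 < v then 1 else -1) else 0) -
     (laplace_cdf ((x om - c) / b) - laplace_cdf ((- x om - c) / b)))).
Proof.
move=> mg mx gM c0 b0.
pose u1 om := (c - x om) / b; pose u2 om := (- x om - c) / b.
have mu1 : measurable_fun [set: S] u1.
  by apply: measurable_funM => //; exact: measurable_funB.
have mu2 : measurable_fun [set: S] u2.
  apply: measurable_funM => //; apply: measurable_funB => //.
  exact: measurableT_comp.
have norm_b01 (t : bool) : `|t%:R : R| <= 1 by case: t; rewrite ?normr1 ?normr0.
have normF y : `|@laplace_cdf R y| <= 1.
  by rewrite ger0_norm ?laplace_cdf_le1 ?laplace_cdf_ge0.
have mF (u : T -> R) : measurable_fun setT u ->
    measurable_fun setT (fun om => laplace_cdf (u om)).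
  by move=> mu; apply: measurableT_comp => //; exact: measurable_laplace_cdf.
have mlt1 : measurable_fun setT (fun om => (u1 om < X om)%R%:R : R).
  apply: measurable_fun_b2r; apply: measurable_fun_ltr => //.
  exact: g_sigma_measurable_fun.
have mlt2 : measurable_fun setT (fun om => (X om < u2 om)%R%:R : R).
  apply: measurable_fun_b2r; apply: measurable_fun_ltr => //.
  exact: g_sigma_measurable_fun.
have M0 : 0 <= M by exact: le_trans (gM point).
have cg (h : T -> R) (K : R) : measurable_fun [set: S] h ->
    (forall om, 0 <= h om) -> (forall om, `|h om| <= K) ->
    centered P (fun om => h om * ((u1 om < X om)%R%:R - (1 - laplace_cdf (u1 om)))) /\
    centered P (fun om => h om * ((X om < u2 om)%R%:R - laplace_cdf (u2 om))).
  move=> mh h0 hK; split.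
    apply: (@centered_mulB _ _ _ P h _ _ K 1) => //.
    - exact: g_sigma_measurable_fun.
    - apply: measurable_funB => //; apply: mF; exact: g_sigma_measurable_fun.
    - by move=> om; rewrite -laplace_cdfN.
    - exact: integral_indep_gt.
  apply: (@centered_mulB _ _ _ P h _ _ K 1) => //.
  - exact: g_sigma_measurable_fun.
  - apply: mF; exact: g_sigma_measurable_fun.
  - exact: integral_indep_lt.
have mgM : measurable_fun [set: S] (fun om => g om + M) by exact: measurable_funD.
have gM0 om : 0 <= g om + M by have := gM om; rewrite ler_norml; lra.
have gM2 om : `|g om + M| <= 2 * M by have := gM om; rewrite !ler_norml; lra.
have [c1 c2] := cg _ _ mgM gM0 gM2.
(* The weight 1 supplies the centered correction needed to undo the shift of g by M. *)
have [c3 c4] : centered P (fun om => 1 * ((u1 om < X om)%R%:R - (1 - laplace_cdf (u1 om)))) /\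
    centered P (fun om => 1 * ((X om < u2 om)%R%:R - laplace_cdf (u2 om))).
  by apply: (cg (fun=> 1) 1) => // om; rewrite normr1.
have e1 : centered P (fun om => g om * ((u1 om < X om)%R%:R - (1 - laplace_cdf (u1 om)))).
  by apply: (centered_shift c1); apply: eq_centered c3 => om; rewrite mul1r.
have e2 : centered P (fun om => g om * ((X om < u2 om)%R%:R - laplace_cdf (u2 om))).
  by apply: (centered_shift c2); apply: eq_centered c4 => om; rewrite mul1r.
apply: eq_centered (centeredD e1 (centeredZ (-1) e2)) => om /=.
have -> : (x om - c) / b = - u1 om by rewrite /u1 -mulNr opprB.
rewrite laplace_cdfN -/(u2 om).
have E1 : (u1 om < X om) = (c < x om + b * X om).
  by rewrite /u1 ltr_pdivrMr // mulrC ltrBlDl.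
have E2 : (X om < u2 om) = (x om + b * X om < - c).
  by rewrite /u2 ltr_pdivlMr //; apply/idP/idP; lra.
set v := x om + b * X om in E1 E2 *.
have -> : (if c < `|v| then if 0 < v then 1 else -1 else 0) =
   (u1 om < X om)%R%:R - (X om < u2 om)%R%:R :> R.
  rewrite E1 E2 lter_normr.
  case: (ltrP c v) => cv /=.
    rewrite (le_lt_trans c0 cv) (_ : v < - c = false) ?subr0 //.
    by apply/negbTE; rewrite -leNgt (le_trans _ (ltW cv)) //; lra.
  rewrite ltrNr; case: (ltrP v (- c)) => vc; last by rewrite subr0.
  by rewrite (_ : 0 < v = false) ?sub0r //; apply/negbTE; rewrite -leNgt; lra.
by ring.
Qed.

End Signal.

(** * Euclidean estimates for one update of one sensor *)

Section Dot.
Context {R : realType}.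

Definition dot {m : nat} (u v : 'cV[R]_m) : R := (u^T *m v) 0 0.

Lemma dotE m (u v : 'cV[R]_m) : dot u v = \sum_r u r 0 * v r 0.
Proof. by rewrite /dot mxE; apply: eq_bigr => r _; rewrite mxE. Qed.

Lemma dotC m (u v : 'cV[R]_m) : dot u v = dot v u.
Proof. by rewrite !dotE; apply: eq_bigr => r _; rewrite mulrC. Qed.

Lemma dotDr m (u v v' : 'cV[R]_m) : dot u (v + v') = dot u v + dot u v'.
Proof. by rewrite /dot mulmxDr mxE. Qed.

Lemma dotZr m (c : R) (u v : 'cV[R]_m) : dot u (c *: v) = c * dot u v.
Proof. by rewrite /dot -scalemxAr mxE. Qed.

Lemma dotDl m (u u' v : 'cV[R]_m) : dot (u + u') v = dot u v + dot u' v.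
Proof. by rewrite dotC dotDr !(dotC v). Qed.

Lemma dotZl m (c : R) (u v : 'cV[R]_m) : dot (c *: u) v = c * dot u v.
Proof. by rewrite dotC dotZr dotC. Qed.

Lemma dotNr m (u v : 'cV[R]_m) : dot u (- v) = - dot u v.
Proof. by rewrite -scaleN1r dotZr mulN1r. Qed.

Lemma dotNl m (u v : 'cV[R]_m) : dot (- u) v = - dot u v.
Proof. by rewrite dotC dotNr dotC. Qed.

Lemma dot_ge0 m (u : 'cV[R]_m) : 0 <= dot u u.
Proof. by rewrite dotE; apply: sumr_ge0 => r _; rewrite -expr2 sqr_ge0. Qed.

Lemma vnorm_sqr m (u : 'cV[R]_m) : vnorm u ^+ 2 = dot u u.
Proof.
rewrite /vnorm sqr_sqrtr; first by rewrite dotE; apply: eq_bigr => r _; rewrite expr2.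
by apply: sumr_ge0 => r _; rewrite sqr_ge0.
Qed.

Lemma dot_mulmx_tr m n (H : 'M[R]_(m, n)) (y : 'cV_m) (e : 'cV_n) :
  dot (H^T *m y) e = dot (H *m e) y.
Proof. by rewrite [RHS]dotC /dot trmx_mul trmxK mulmxA. Qed.

Lemma dot_add_le m (u v : 'cV[R]_m) :
  dot (u + v) (u + v) <= 2 * dot u u + 2 * dot v v.
Proof.
have := dot_ge0 (u - v); rewrite !(dotDl, dotDr, dotNl, dotNr) (dotC v u).
lra.
Qed.

(** Cauchy-Schwarz for u in the unit ball: expand the square of v minus (u.v) u. *)
Lemma dot_sqr_le m (u v : 'cV[R]_m) : dot u u <= 1 -> dot u v ^+ 2 <= dot v v.
Proof.
move=> u1; have := dot_ge0 (v - dot u v *: u).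
rewrite !(dotDl, dotDr, dotNl, dotNr, dotZl, dotZr) (dotC v u) => h.
have : 0 <= dot u v ^+ 2 by exact: sqr_ge0.
nra.
Qed.

(** A matrix and its transpose have the same operator norm. With z = H^T y one has z.z = (H z).y,
    and expanding the square of H z - C y gives C (C y.y - z.z) >= 0. *)
Lemma dot_tr_le m n (H : 'M[R]_(m, n)) (C : R) (y : 'cV_m) : 0 < C ->
  (forall x : 'cV_n, dot (H *m x) (H *m x) <= C * dot x x) ->
  dot (H^T *m y) (H^T *m y) <= C * dot y y.
Proof.
move=> C0 hH; set z := H^T *m y.
have E : dot z z = dot (H *m z) y by rewrite {1}/z dot_mulmx_tr.
have := dot_ge0 (H *m z - C *: y).
rewrite !(dotDl, dotDr, dotNl, dotNr, dotZl, dotZr) (dotC y) -E => h.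
have := hH z => h2.
have h3 : 0 <= C * (C * dot y y - dot z z) by nra.
by move: h3; rewrite pmulr_rge0 // subr_ge0.
Qed.

(** The innovation contributes - 2 be |H e|^2 to the cross term, which is dropped. The quadratic
    part is split twice by |u + v|^2 <= 2 |u|^2 + 2 |v|^2, whence the factors 4. *)
Lemma node_step_le m n (H : 'M[R]_(m, n)) (C s be : R) (p e : 'cV_n) (w : 'cV_m) :
  0 < C -> (forall x : 'cV_n, dot (H *m x) (H *m x) <= C * dot x x) ->
  dot p p <= 1 -> 0 <= be ->
  forall e', e' = e + s *: p + be *: (H^T *m (w - H *m e)) ->
  dot e' e' <= (1 + 4 * C ^+ 2 * be ^+ 2) * dot e e + 2 * (s * dot p e) +
    2 * (be * dot (H *m e) w) + (2 * s ^+ 2 + 4 * C * be ^+ 2 * dot w w).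
Proof.
move=> C0 hH p1 be0 e' e'E.
set u := H^T *m (w - H *m e).
have hu : dot u u <= 2 * C * dot w w + 2 * C ^+ 2 * dot e e.
  apply: (le_trans (dot_tr_le _ C0 hH)).
  have h1 : dot (w - H *m e) (w - H *m e) <= 2 * dot w w + 2 * (C * dot e e).
    apply: (le_trans (dot_add_le _ _)); rewrite dotNl dotNr opprK lerD2l.
    by rewrite ler_pM2l.
  have := ler_wpM2l (ltW C0) h1; nra.
have eu : dot e u = dot (H *m e) w - dot (H *m e) (H *m e).
  by rewrite dotC dot_mulmx_tr dotDr dotNr.
have hs : dot (s *: p + be *: u) (s *: p + be *: u) <= 2 * s ^+ 2 + 2 * (be ^+ 2 * dot u u).
  apply: (le_trans (dot_add_le _ _)); rewrite !(dotZl, dotZr).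
  have : s ^+ 2 * dot p p <= s ^+ 2 by rewrite -[leRHS]mulr1 ler_wpM2l // sqr_ge0.
  nra.
have -> : dot e' e' = dot e e + 2 * (s * dot p e) + 2 * (be * dot e u) +
    dot (s *: p + be *: u) (s *: p + be *: u).
  have qE : dot e (s *: p + be *: u) = s * dot p e + be * dot e u.
    by rewrite dotDr !dotZr (dotC e p).
  rewrite e'E -/u -addrA; move: (s *: p + be *: u) qE => q qE.
  by rewrite !(dotDl, dotDr) (dotC q e) qE; ring.
have hH0 := dot_ge0 (H *m e).
have hbe : be ^+ 2 * dot u u <= be ^+ 2 * (2 * C * dot w w + 2 * C ^+ 2 * dot e e).
  by apply: ler_wpM2l => //; rewrite sqr_ge0.
have hbh : 0 <= be * dot (H *m e) (H *m e) by rewrite mulr_ge0.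
rewrite eu mulrBr; lra.
Qed.

(** The constant is crude but depends only on the length of the list, which is enough for
    summability over time. *)
Lemma sqr_sum_le (I : Type) (s : seq I) (Q : pred I) (x : I -> R) :
  (\sum_(i <- s | Q i) x i) ^+ 2 <= 2 ^+ size s * \sum_(i <- s | Q i) x i ^+ 2.
Proof.
elim: s => [|i s IH] /=; first by rewrite !big_nil expr0n mulr0.
have S0 : 0 <= \sum_(i <- s | Q i) x i ^+ 2 by apply: sumr_ge0 => j _; rewrite sqr_ge0.
have P1 : 1 <= 2 ^+ size s :> R by rewrite exprn_ege1 // ler1n.
rewrite !big_cons [2 ^+ _.+1]exprS; case: (Q i); last first.
  apply: (le_trans IH); rewrite -mulrA -[leLHS]mul1r; apply: ler_wpM2r.
    by rewrite mulr_ge0 // (le_trans ler01).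
  by rewrite ler1n.
set S := \sum_(j <- s | Q j) x j in IH *.
set S2 := \sum_(j <- s | Q j) x j ^+ 2 in IH S0 *.
have h : (x i + S) ^+ 2 <= 2 * x i ^+ 2 + 2 * S ^+ 2.
  have := sqr_ge0 (x i - S); nra.
have h2 : x i ^+ 2 <= 2 ^+ size s * x i ^+ 2.
  by rewrite -[leLHS]mul1r ler_wpM2r // sqr_ge0.
lra.
Qed.

(** An inequality because of n = 0, where the vector is empty; otherwise the value is 1. *)
Lemma phi_dot_le1 n k : dot (phi n k : 'cV[R]_n) (phi n k) <= 1.
Proof.
rewrite dotE; case: n => [|n]; first by rewrite big_ord0.
have lt : (k.-1 %% n.+1 < n.+1)%N by rewrite ltn_pmod.
rewrite (bigD1 (Ordinal lt)) //= big1 ?addr0.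
  by rewrite !mxE eqxx mulr1.
move=> j /eqP jne; rewrite !mxE; case: eqP => [jE|]; last by rewrite mulr0.
by case: jne; exact: val_inj.
Qed.

End Dot.

(** * Bounded partial sums *)

Section Summable.
Context {R : realType}.
Implicit Types u v : nat -> R.

(** The form in which the maximal inequality consumes summability. Indices start at 0, so step
    sizes, which start at time 1, enter shifted by one. *)
Definition bounded_psums u : Prop :=
  exists K : R, forall n, \sum_(j < n) u j <= K.

Lemma bounded_psums_series u : (forall k, (1 <= k)%N -> 0 <= u k) ->
  (\sum_(1 <= k <oo) (u k)%:E < +oo)%E -> bounded_psums (fun k => u k.+1).
Proof.
move=> u0 uoo.
have s0 : (0 <= \sum_(1 <= k <oo) (u k)%:E)%E.
  by apply: nneseries_ge0 => k k1 _; rewrite lee_fin u0.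
exists (fine (\sum_(1 <= k <oo) (u k)%:E)%E) => n.
rewrite -lee_fin fineK; last by rewrite ge0_fin_numE.
have -> : ((\sum_(j < n) u j.+1)%:E = \sum_(1 <= k < n.+1) (u k)%:E)%E.
  by rewrite big_add1 /= big_mkord sumEFin.
by apply: nneseries_lim_ge => k k1 _; rewrite lee_fin u0.
Qed.

Lemma bounded_psumsZ (c : R) u : 0 <= c -> bounded_psums u ->
  bounded_psums (fun k => c * u k).
Proof.
by move=> c0 [K hK]; exists (c * K) => n; rewrite -mulr_sumr; apply: ler_wpM2l.
Qed.

Lemma bounded_psumsD u v : bounded_psums u -> bounded_psums v ->
  bounded_psums (fun k => u k + v k).
Proof.
by move=> [K hK] [L hL]; exists (K + L) => n; rewrite big_split /=; apply: lerD; [exact: hK|exact: hL].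
Qed.

Lemma bounded_psums_sum (I : Type) (s : seq I) (Q : pred I) (u : I -> nat -> R) :
  (forall i, Q i -> bounded_psums (u i)) ->
  bounded_psums (fun k => \sum_(i <- s | Q i) u i k).
Proof.
move=> hu; elim: s => [|i s [K hK]].
  by exists 0 => n; rewrite big1 // => j _; rewrite big_nil.
case Qi : (Q i); last first.
  exists K => n; apply: le_trans (hK n); rewrite le_eqVlt; apply/orP; left.
  by apply/eqP; apply: eq_bigr => j _; rewrite big_cons Qi.
have [L hL] := hu i Qi; exists (L + K) => n.
under eq_bigr do rewrite big_cons Qi.
by rewrite big_split /=; apply: lerD; [exact: hL|exact: hK].
Qed.

Lemma bounded_psums_le u v : (forall k, u k <= v k) -> bounded_psums v ->
  bounded_psums u.
Proof.
move=> uv [K hK]; exists K => n; apply: le_trans (hK n).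
by apply: ler_sum => j _.
Qed.
End Summable.

Lemma measurable_sum_cond (R : realType) (d : measure_display)
    (T : measurableType d) (I : Type) (s : seq I) (Q : pred I) (h : I -> T -> R) :
  (forall i, Q i -> measurable_fun setT (h i)) ->
  measurable_fun setT (fun x => \sum_(i <- s | Q i) h i x).
Proof.
move=> mh; rewrite (_ : (fun x => _) =
    (fun x => \sum_(i <- s) (if Q i then h i x else 0))).
  by apply: measurable_sum => i; case Qi : (Q i) => //; exact: mh.
by apply/funext => x; rewrite big_mkcond.
Qed.

(** * The filtrations, and independence of the next dither from the past *)

Section FiltrationTheory.
Context {R : realType} {d : measure_display} {T : measurableType d}.
Variables (N : nat) (m : 'I_N -> nat).
Variable w : forall i : 'I_N, nat -> T -> 'cV[R]_(m i).
Variable dn : 'I_N -> nat -> T -> R.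
Hypothesis w_meas : forall (i : 'I_N) (k : nat) (r : 'I_(m i)),
  measurable_fun setT (fun om => w i k om r 0 : R).
Hypothesis d_meas : forall (i : 'I_N) (k : nat), measurable_fun setT (dn i k).

Lemma Gw_meas k : Gw w k `<=` measurable.
Proof.
move=> _ [i [t [r [_ [B [mB ->]]]]]].
by rewrite -[X in measurable X]setTI; exact: w_meas.
Qed.

Lemma Gd_meas k : Gd dn k `<=` measurable.
Proof.
move=> _ [i [t [_ [B [mB ->]]]]].
by rewrite -[X in measurable X]setTI; exact: d_meas.
Qed.

Lemma g_sigma_sub_measurable (G : set (set T)) :
  G `<=` measurable -> <<s G >> `<=` measurable.
Proof. by move=> Gm; apply: smallest_sub => //; exact: sigma_algebra_measurable. Qed.

Lemma Fsig_sigma k : sigma_algebra setT (Fsig w dn k).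
Proof. exact: smallest_sigma_algebra. Qed.

Lemma Fsig_meas k : Fsig w dn k `<=` measurable.
Proof.
by apply: g_sigma_sub_measurable => A [/Gw_meas|/Gd_meas].
Qed.

Lemma Fwsig_meas k : Fwsig w k `<=` measurable.
Proof. by apply: g_sigma_sub_measurable; exact: Gw_meas. Qed.

Lemma Fw_all_meas : Fw_all w `<=` measurable.
Proof. by apply: g_sigma_sub_measurable => A [k /Gw_meas]. Qed.

Lemma sig_d_meas i k : sig_d dn i k `<=` measurable.
Proof.
apply: g_sigma_sub_measurable => _ [B [mB ->]].
by rewrite -[X in measurable X]setTI; exact: d_meas.
Qed.

Lemma Fwsig_Fsig k : Fwsig w k `<=` Fsig w dn k.
Proof. by apply: sub_sigma_algebra2 => A; left. Qed.

Lemma Fsig_incr k : Fsig w dn k `<=` Fsig w dn k.+1.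
Proof.
apply: sub_sigma_algebra2 => A [[i [t [r [/andP[t1 tk] h]]]]|[i [t [/andP[t1 tk] h]]]].
  by left; exists i, t, r; rewrite t1 (leqW tk).
by right; exists i, t; rewrite t1 (leqW tk).
Qed.

Local Notation S k := (g_sigma_algebraType (Gw w k `|` Gd dn k)).

Lemma measurable_fun_FsigS k (f : T -> R) :
  measurable_fun [set: S k] f -> measurable_fun [set: S k.+1] f.
Proof. by move=> mf _ B mB; apply: Fsig_incr; exact: mf. Qed.

Lemma measurable_fun_Fsig k (f : T -> R) :
  measurable_fun [set: S k] f -> measurable_wrt (Fsig w dn k) f.
Proof. by move=> mf B mB; rewrite -[X in Fsig _ _ _ X]setTI; exact: mf. Qed.

Lemma measurable_fun_Fsig_T k (f : T -> R) :
  measurable_fun [set: S k] f -> measurable_fun setT f.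
Proof. by move=> mf _ B mB; apply: (@Fsig_meas k); exact: mf. Qed.

Lemma w_Fsig_meas i k (r : 'I_(m i)) :
  measurable_fun [set: S k.+1] (fun om => w i k.+1 om r 0 : R).
Proof.
move=> _ B mB; rewrite setTI; apply: sub_gen_smallest; left.
by exists i, k.+1, r; split; [rewrite leqnn|exists B].
Qed.

Lemma dn_Fsig_meas i k : measurable_fun [set: S k.+1] (dn i k.+1).
Proof.
move=> _ B mB; rewrite setTI; apply: sub_gen_smallest; right.
by exists i, k.+1; split; [rewrite leqnn|exists B].
Qed.

Lemma indic_Fsig_meas k B : Fsig w dn k B ->
  measurable_fun [set: S k] (\1_B : T -> R).
Proof. by move=> FB; apply: (@measurable_indic _ (S k)). Qed.

Variable P : probability T R.
Hypothesis d_indep : mutually_independent P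
  (fun o : option ('I_N * nat) => match o with
     | None => Fw_all w
     | Some (i, k) => sig_d dn i k.+1
     end).

(** F_k lies in the join of finitely many members of the independent family: the sigma-algebra of
    all the w and the dithers of times 1 to k. *)
Lemma Fsig_indep_dn k i (A : set T) (B : set R) :
  Fsig w dn k A -> measurable B ->
  P (A `&` dn i k.+1 @^-1` B) = (P A * P (dn i k.+1 @^-1` B))%E.
Proof.
move=> FA mB.
(* [Some (j, t)] stands for time t + 1, so t < k covers the times up to k and leaves [Some (i, k)]
   out. *)
pose J : seq (option ('I_N * nat)) :=
  None :: [seq Some (j, t) | j <- enum 'I_N, t <- iota 0 k].
have inJ j t : (t < k)%N -> Some (j, t) \in J.
  move=> tk; rewrite inE; apply/orP; right.
  by apply/allpairsP; exists (j, t); rewrite /= mem_enum mem_iota.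
apply: (mutually_independent_join _ _ d_indep (J := J) (i := Some (i, k))).
- by case=> [[j t]|]; exact: smallest_sigma_algebra.
- by case=> [[j t]|]; [exact: sig_d_meas|exact: Fw_all_meas].
- rewrite /= ?inE /=; apply/and3P; split.
  + by apply/negP => /allpairsP[[j t] [_ /=]]; rewrite mem_iota /= add0n => tk [_ kE]; move: tk; rewrite kE ltnn.
  + by apply/negP => /allpairsP[[j t] [_ _]].
  + apply: allpairs_uniq => //; [exact: enum_uniq|exact: iota_uniq|].
    by move=> [j t] [j' t'] _ _ /= [-> ->].
- apply: sub_sigma_algebra2 FA => X [[j [t [r [/andP[t1 tk] [C [mC ->]]]]]]|[j [t [/andP[t1 tk] [C [mC ->]]]]]].
    exists None; first by rewrite inE.
    apply: sub_gen_smallest; exists k, j, t, r; rewrite t1 tk; split => //.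
    by exists C.
  exists (Some (j, t.-1)); first by apply: inJ; rewrite prednK.
  by rewrite prednK //; apply: sub_gen_smallest; exists C.
- by apply: sub_gen_smallest; exists B.
Qed.

End FiltrationTheory.

(** * Almost sure boundedness of the estimates *)

Section Energy.
Context {R : realType} {dsp : measure_display} {T : measurableType dsp}.
Variable P : probability T R.
Variables (N n : nat) (m : 'I_N -> nat).
Variable a : 'I_N -> 'I_N -> R.
Variable H : forall i : 'I_N, nat -> 'M[R]_(m i, n).
Variable theta : 'cV[R]_n.
Variable w : forall i : 'I_N, nat -> T -> 'cV[R]_(m i).
Variable dn : 'I_N -> nat -> T -> R.
Variable theta0 : 'I_N -> 'cV[R]_n.
Variables (nu b : 'I_N -> 'I_N -> R).
Variable alpha : 'I_N -> 'I_N -> nat -> R.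
Variable beta : 'I_N -> nat -> R.
Hypothesis a_sym : forall i j, a i j = a j i.
Variable Hbar : R.
Hypothesis Hbar_gt0 : 0 < Hbar.
Hypothesis H_bnd : forall (i : 'I_N) (k : nat), (1 <= k)%N ->
  forall x : 'cV[R]_n, vnorm (H i k *m x) <= Hbar * vnorm x.
Hypothesis w_meas : forall (i : 'I_N) (k : nat) (r : 'I_(m i)),
  measurable_fun setT (fun om => w i k om r 0).
Hypothesis d_meas : forall (i : 'I_N) (k : nat), measurable_fun setT (dn i k).
Hypothesis w_mds : forall (i : 'I_N) (k : nat), (1 <= k)%N ->
  forall r : 'I_(m i), cond_exp_zero P (Fsig w dn k.-1) (fun om => w i k om r 0).
Hypothesis d_lap : forall (i : 'I_N) (k : nat), (1 <= k)%N -> forall x : R,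
  P [set om | dn i k om <= x] = (laplace_cdf x)%:E.
Hypothesis d_indep : mutually_independent P
  (fun o : option ('I_N * nat) => match o with
     | None => Fw_all w
     | Some (i, k) => sig_d dn i k.+1
     end).
Hypothesis nuP : forall i j, 0 < a i j -> nu i j = nu j i /\ 0 <= nu i j.
Hypothesis bP : forall i j, 0 < a i j -> b i j = b j i /\ 0 < b i j.
Hypothesis alphaP : forall i j k, 0 < a i j -> (1 <= k)%N ->
  alpha i j k = alpha j i k /\ 0 < alpha i j k.
Hypothesis beta_gt0 : forall i k, (1 <= k)%N -> 0 < beta i k.

Local Notation S k := (g_sigma_algebraType (Gw w k `|` Gd dn k)).
Local Notation th := (theta_hat a H theta w dn theta0 nu b alpha beta).

Lemma xval_dot k (v : 'cV[R]_n) : xval k v = dot (phi n k) v.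
Proof. by []. Qed.

Lemma step_entry k om st i r :
  step a H theta w dn nu b alpha beta k om st i r 0 = st i r 0 +
  (\sum_(j < N | 0 < a i j) alpha i j k * a i j *
    (shat dn nu b j i k (xval k (st j)) om - Gfun nu b i j k (xval k (st i)))) *
    phi n k r 0 +
  beta i k * \sum_s (H i k s r * ((H i k *m theta) s 0 + w i k om s 0 -
    \sum_q H i k s q * st i q 0)).
Proof.
rewrite /step !mxE; congr (_ + _ * _ + _ * _).
apply: eq_bigr => s _; rewrite !mxE; congr (_ * _); congr (_ - _).
Qed.

Lemma Gfun_meas i j k : measurable_fun setT (Gfun nu b i j k).
Proof.
apply: measurable_funB; apply: measurableT_comp => //;
  try exact: measurable_laplace_cdf.
  by apply: measurable_funM => //; exact: measurable_funB.
by apply: measurable_funM => //; exact: measurable_funB.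
Qed.

Lemma xval_meas (d' : measure_display) (U : measurableType d') k (f : U -> 'cV[R]_n) :
  (forall r, measurable_fun setT (fun om => f om r 0)) ->
  measurable_fun setT (fun om => xval k (f om)).
Proof.
move=> mf; rewrite (_ : (fun om => _) = (fun om => \sum_r phi n k r 0 * f om r 0)).
  by apply: measurable_sum => r; exact: measurable_funM.
by apply/funext => om; rewrite xval_dot dotE.
Qed.

Lemma shat_meas (d' : measure_display) (U : measurableType d')
    (D x : U -> R) (c : R) (bb : R) :
  measurable_fun setT D -> measurable_fun setT x ->
  measurable_fun setT (fun om => let v := x om + bb * D om in
    (if c < `|v| then (if 0 < v then 1 else -1) else 0) : R).
Proof.
move=> mD mx /=.
have mv : measurable_fun setT (fun om => x om + bb * D om).
  by apply: measurable_funD => //; exact: measurable_funM.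
apply: measurable_fun_ifT => //.
  by apply: measurable_fun_ltr => //; exact: measurableT_comp.
by apply: measurable_fun_ifT => //; exact: measurable_fun_ltr.
Qed.

Lemma theta_hat_meas k i r : measurable_fun [set: S k] (fun om => th k om i r 0).
Proof.
elim: k i r => [|k IH] i r; first exact: measurable_cst.
have mth j q : measurable_fun [set: S k.+1] (fun om => th k om j q 0).
  by apply: measurable_fun_FsigS; exact: IH.
have mx j : measurable_fun [set: S k.+1] (fun om => xval k.+1 (th k om j)).
  by apply: (@xval_meas _ (S k.+1)); exact: mth.
rewrite (_ : (fun om => _) = (fun om => th k om i r 0 +
  (\sum_(j < N | 0 < a i j) alpha i j k.+1 * a i j *
    (shat dn nu b j i k.+1 (xval k.+1 (th k om j)) om -
     Gfun nu b i j k.+1 (xval k.+1 (th k om i)))) * phi n k.+1 r 0 +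
  beta i k.+1 * \sum_s (H i k.+1 s r * ((H i k.+1 *m theta) s 0 +
     w i k.+1 om s 0 - \sum_q H i k.+1 s q * th k om i q 0)))); last first.
  by apply/funext => om; rewrite /= step_entry.
apply: measurable_funD; [apply: measurable_funD|]; first exact: mth.
- apply: measurable_funM => //; apply: (@measurable_sum_cond _ _ (S k.+1)) => j _.
  apply: measurable_funM => //; apply: measurable_funB.
    apply: (@shat_meas _ (S k.+1)) => //; exact: dn_Fsig_meas.
  by apply: (measurableT_comp (Gfun_meas _ _ _)); exact: mx.
- apply: measurable_funM => //; apply: (@measurable_sum _ (S k.+1)) => s.
  apply: measurable_funM => //; apply: measurable_funB.
    by apply: measurable_funD => //; exact: w_Fsig_meas.
  by apply: (@measurable_sum _ (S k.+1)) => q; exact: measurable_funM.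
Qed.

Definition err k om i : 'cV[R]_n := th k om i - theta.

Definition energy k om : R := \sum_i dot (err k om i) (err k om i).

Lemma err_meas k i r : measurable_fun [set: S k] (fun om => err k om i r 0).
Proof.
rewrite (_ : (fun om => _) = (fun om => th k om i r 0 - theta r 0)).
  by apply: measurable_funB => //; exact: theta_hat_meas.
by apply/funext => om; rewrite !mxE.
Qed.

Lemma energy_meas k : measurable_fun [set: S k] (energy k).
Proof.
rewrite /energy; apply: (@measurable_sum _ (S k)) => i.
rewrite (_ : (fun om => _) = (fun om => \sum_r err k om i r 0 * err k om i r 0)).
  by apply: (@measurable_sum _ (S k)) => r; apply: measurable_funM; exact: err_meas.
by apply/funext => om; rewrite dotE.
Qed.

Lemma energy_ge0 k om : 0 <= energy k om.
Proof. by apply: sumr_ge0 => i _; exact: dot_ge0. Qed.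

Lemma dot_err_le k om i : dot (err k om i) (err k om i) <= energy k om.
Proof.
rewrite /energy (bigD1 i) //= lerDl; apply: sumr_ge0 => j _; exact: dot_ge0.
Qed.

Lemma H_dot_le i k (x : 'cV[R]_n) : (1 <= k)%N ->
  dot (H i k *m x) (H i k *m x) <= Hbar ^+ 2 * dot x x.
Proof.
move=> k1; rewrite -!vnorm_sqr -exprMn ler_pXn2r ?nnegrE ?sqrtr_ge0 //.
- exact: H_bnd.
- by rewrite mulr_ge0 ?sqrtr_ge0 // ltW.
Qed.

Lemma Gfun_homo i j k (x y : R) : 0 < a i j -> x <= y ->
  Gfun nu b i j k x <= Gfun nu b i j k y.
Proof.
move=> /bP[_ b0] xy; rewrite /Gfun; apply: lerB; apply: le_laplace_cdf;
  by rewrite ler_pM2r ?invr_gt0 // lerB // lerN2.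
Qed.

Lemma GfunC i j k : 0 < a i j -> Gfun nu b i j k = Gfun nu b j i k.
Proof.
move=> aij; have [-> _] := nuP aij; have [bE _] := bP aij.
by apply/funext => x; rewrite /Gfun /Cthr (nuP aij).1 bE.
Qed.

Lemma shat_Gfun_le2 j i k x y om :
  `|shat dn nu b j i k x om - Gfun nu b i j k y| <= 2.
Proof.
have h1 : `|shat dn nu b j i k x om| <= 1.
  by rewrite /shat; case: ifP => _; [case: ifP => _|];
    rewrite ?normrN ?normr1 ?normr0.
have h2 : `|Gfun nu b i j k y| <= 1.
  rewrite /Gfun ler_norml.
  have := laplace_cdf_ge0 ((y - Cthr nu b i j k) / b i j).
  have := laplace_cdf_le1 ((y - Cthr nu b i j k) / b i j).
  have := laplace_cdf_ge0 ((- y - Cthr nu b i j k) / b i j).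
  have := laplace_cdf_le1 ((- y - Cthr nu b i j k) / b i j).
  by move=> ? ? ? ?; lra.
by apply: (le_trans (ler_normB _ _)); lra.
Qed.

(** The mean-zero part of the energy increment. Each signal is compensated by G at the value of its
    sender j, so what is left of the consensus term compares G at x_j with G at x_i. *)
Definition noise k om : R :=
  \sum_i \sum_(j < N | 0 < a i j) 2 * (alpha i j k.+1 * a i j) *
    (dot (phi n k.+1) (err k om i) *
      (shat dn nu b j i k.+1 (xval k.+1 (th k om j)) om -
       Gfun nu b j i k.+1 (xval k.+1 (th k om j)))) +
  \sum_i \sum_r 2 * beta i k.+1 *
    ((H i k.+1 *m err k om i) r 0 * w i k.+1 om r 0).

(** The coefficient in [node_step_le] for C = [Hbar ^+ 2]. The sum over the sensors dominates each
    of its terms, so one factor serves the whole energy. *)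
Definition growth k : R := 4 * (Hbar ^+ 2) ^+ 2 * \sum_i beta i k.+1 ^+ 2.

(** Bounds the terms [2 * s ^+ 2] of [node_step_le]; the inner factor 2 is the bound of
    [shat_Gfun_le2]. *)
Definition drift k : R :=
  2 * \sum_i (\sum_(j < N | 0 < a i j) 2 * (alpha i j k.+1 * a i j)) ^+ 2.

Definition wsq k om : R := 4 * Hbar ^+ 2 *
  \sum_i beta i k.+1 ^+ 2 * dot (w i k.+1 om) (w i k.+1 om).

(* Symmetry of the weights turns the sum into
   [- 1/2 sum alpha a (x_i - x_j) (G x_i - G x_j)], and G is nondecreasing. *)
Lemma consensus_le0 k (x : 'I_N -> R) (t : R) :
  \sum_i \sum_(j < N | 0 < a i j) alpha i j k.+1 * a i j *
    ((x i - t) * (Gfun nu b j i k.+1 (x j) - Gfun nu b i j k.+1 (x i))) <= 0.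
Proof.
set S := \sum_i _.
pose f i j := alpha i j k.+1 * a i j *
    ((x i - t) * (Gfun nu b j i k.+1 (x j) - Gfun nu b i j k.+1 (x i))).
have S2 : S = \sum_i \sum_(j < N | 0 < a i j) f j i.
  rewrite /S (exchange_big_dep xpredT) //=; apply: eq_bigr => i _.
  by apply: eq_bigl => j; rewrite a_sym.
have -> : S = 2^-1 * (S + S) by field.
rewrite {2}S2 /S -big_split /=; apply: mulr_ge0_le0; first by rewrite invr_ge0.
apply: sumr_le0 => i _; rewrite -big_split /=; apply: sumr_le0 => j aij.
rewrite /f (a_sym j i) -(alphaP aij (ltn0Sn k)).1 -(GfunC _ aij).
rewrite -mulrDr.
have al0 := (alphaP aij (ltn0Sn k)).2.
apply: mulr_ge0_le0; first by rewrite mulr_ge0 // ltW.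
have [xy|/ltW xy] := leP (x i) (x j); have := Gfun_homo k.+1 aij xy; nra.
Qed.

Lemma err_step k om i : err k.+1 om i = err k om i +
  (\sum_(j < N | 0 < a i j) alpha i j k.+1 * a i j *
    (shat dn nu b j i k.+1 (xval k.+1 (th k om j)) om -
     Gfun nu b i j k.+1 (xval k.+1 (th k om i)))) *: phi n k.+1 +
  beta i k.+1 *: ((H i k.+1)^T *m (w i k.+1 om - H i k.+1 *m err k om i)).
Proof.
rewrite /err [th k.+1 om]/= /step; set s := \sum_(j < N | _) _.
have -> : H i k.+1 *m theta + w i k.+1 om - H i k.+1 *m th k om i =
    w i k.+1 om - H i k.+1 *m (th k om i - theta).
  by rewrite mulmxBr opprB [RHS]addrA (addrC (w i k.+1 om)).
by rewrite -!addrA; congr (_ + _); rewrite [RHS]addrC -!addrA.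
Qed.

(** A pathwise inequality. Writing the received signal minus G(x_i) as (signal - G(x_j)) + (G(x_j) -
    G(x_i)) sends the first part to [noise] and the second to [consensus_le0]. *)
Lemma energy_step_le k om :
  energy k.+1 om <=
    ((1 + growth k) * energy k om + (drift k + wsq k om)) + noise k om.
Proof.
pose s i := \sum_(j < N | 0 < a i j) alpha i j k.+1 * a i j *
    (shat dn nu b j i k.+1 (xval k.+1 (th k om j)) om -
     Gfun nu b i j k.+1 (xval k.+1 (th k om i))).
pose e := err k om.
have C0 : 0 < Hbar ^+ 2 by rewrite exprn_gt0.
have node i : dot (err k.+1 om i) (err k.+1 om i) <=
    (dot (e i) (e i) + growth k * dot (e i) (e i)) +
    (2 * (\sum_(j < N | 0 < a i j) 2 * (alpha i j k.+1 * a i j)) ^+ 2 +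
     4 * Hbar ^+ 2 * (beta i k.+1 ^+ 2 * dot (w i k.+1 om) (w i k.+1 om))) +
    (2 * (s i * dot (phi n k.+1) (e i)) +
     2 * (beta i k.+1 * dot (H i k.+1 *m e i) (w i k.+1 om))).
  have be0 := ltW (beta_gt0 i (ltn0Sn k)).
  apply: (le_trans (node_step_le C0 (fun x => @H_dot_le i k.+1 x isT)
    (phi_dot_le1 n k.+1) be0 (err_step k om i))).
  have hs : s i ^+ 2 <= (\sum_(j < N | 0 < a i j) 2 * (alpha i j k.+1 * a i j)) ^+ 2.
    rewrite -[leLHS]real_normK ?num_real // ler_pXn2r ?nnegrE //; last first.
      apply: sumr_ge0 => j aij; rewrite !mulr_ge0 // ?ltW //.
      exact: (alphaP aij (ltn0Sn k)).2.
    apply: (le_trans (ler_norm_sum _ _ _)); apply: ler_sum => j aij.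
    have al0 := (alphaP aij (ltn0Sn k)).2.
    rewrite normrM ger0_norm; last by rewrite mulr_ge0 // ltW.
    by rewrite mulrC ler_wpM2r ?shat_Gfun_le2 // mulr_ge0 // ltW.
  have hb : 4 * (Hbar ^+ 2) ^+ 2 * beta i k.+1 ^+ 2 * dot (e i) (e i) <=
      growth k * dot (e i) (e i).
    rewrite ler_wpM2r ?dot_ge0 // /growth ler_pM2l ?mulr_gt0 ?exprn_gt0 //.
    rewrite (bigD1 i) //= lerDl; apply: sumr_ge0 => j _; exact: sqr_ge0.
  rewrite -/(e i) -/(s i); move: hs hb; lra.
rewrite /energy; apply: (le_trans (ler_sum _ (fun i _ => node i))).
rewrite !big_split /= -!mulr_sumr -/(energy k om) (mulrDl 1 (growth k)) mul1r /wsq.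
rewrite -/(drift k) lerD2l /noise.
apply: lerD; last first.
  rewrite mulr_sumr; apply: ler_sum => i _.
  rewrite dotE !mulr_sumr le_eqVlt; apply/orP; left; apply/eqP.
  by apply: eq_bigr => r _; rewrite mulrA.
(* The shift t is the coordinate of theta, since phi.e_i = x_i - phi.theta. *)
have := consensus_le0 k (fun i => xval k.+1 (th k om i)) (xval k.+1 theta).
set Cons := \sum_i _ => cons0.
set rhs := (X in _ <= X).
have -> : 2 * \sum_i s i * dot (phi n k.+1) (e i) = rhs + 2 * Cons.
  rewrite /rhs /Cons !mulr_sumr -big_split /=; apply: eq_bigr => i _.
  rewrite /s mulr_suml !mulr_sumr -big_split /=; apply: eq_bigr => j aij.
  have -> : dot (phi n k.+1) (err k om i) = xval k.+1 (th k om i) - xval k.+1 theta.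
    by rewrite /err dotDr dotNr.
  by ring.
by rewrite gerDl pmulr_rle0.
Qed.
(** Uses |x| <= 1 + x^2, which avoids square roots; only some finite bound is wanted. *)
Lemma indic_mul_bound (B : set T) (f : T -> R) (lam : R) :
  (forall om, B om -> f om ^+ 2 <= lam) -> forall om, `|\1_B om * f om| <= 1 + `|lam|.
Proof.
move=> fB om; rewrite indicE; case: (asboolP (B om)) => hB.
  rewrite mem_set // mul1r; have h1 := fB _ hB; have h2 := ler_norm lam.
  rewrite -[f om ^+ 2]real_normK ?num_real // in h1.
  have := sqr_ge0 (`|f om| - 1); nra.
by rewrite memNset // mul0r normr0 addr_ge0.
Qed.

(** Restricting to B, where the energy is at most lam, makes all weights bounded. The dithers are
    then handled by [centered_signal] and the observation noise by [centered_mds]. *)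
Lemma noise_centered k (B : set T) (lam : R) : Fsig w dn k B ->
  (forall om, B om -> energy k om <= lam) ->
  centered P (fun om => \1_B om * noise k om).
Proof.
move=> FB Blam.
have mB := indic_Fsig_meas FB.
have mdot i : measurable_fun [set: S k] (fun om => dot (phi n k.+1) (err k om i)).
  by apply: (@xval_meas _ (S k)); exact: err_meas.
have mH i r : measurable_fun [set: S k] (fun om => (H i k.+1 *m err k om i) r 0).
  rewrite (_ : (fun om => _) = (fun om => \sum_q H i k.+1 r q * err k om i q 0)).
    by apply: (@measurable_sum _ (S k)) => q; apply: measurable_funM => //; exact: err_meas.
  by apply/funext => om; rewrite mxE.
have c1 : centered P (fun om => \sum_i \sum_(j < N | 0 < a i j)
    2 * (alpha i j k.+1 * a i j) * ((\1_B om * dot (phi n k.+1) (err k om i)) *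
      (shat dn nu b j i k.+1 (xval k.+1 (th k om j)) om -
       Gfun nu b j i k.+1 (xval k.+1 (th k om j))))).
  apply: centered_sum => i _; apply: centered_sum => j aij; apply: centeredZ.
  (* Sensor i hears what j sends, so threshold and scale carry the index (j, i). *)
  have aji : 0 < a j i by rewrite a_sym.
  apply: (@centered_signal _ _ _ P (Gw w k `|` Gd dn k) (dn j k.+1) _ _ _ _
    (fun om => \1_B om * dot (phi n k.+1) (err k om i))
    (fun om => xval k.+1 (th k om j)) (1 + `|lam|)).
  - exact: Fsig_meas.
  - exact: d_meas.
  - exact: d_lap.
  - by move=> A C FA mC; exact: Fsig_indep_dn.
  - exact: measurable_funM.
  - by apply: (@xval_meas _ (S k)); exact: theta_hat_meas.
  - apply: indic_mul_bound => om hB; apply: le_trans (Blam _ hB).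
    apply: le_trans (dot_err_le _ _ i); apply: dot_sqr_le; exact: phi_dot_le1.
  - rewrite /Cthr !mulr_ge0 //; [exact: (nuP aji).2|exact/ltW/(bP aji).2|].
    by rewrite ln_ge0 // ler1n.
  - exact: (bP aji).2.
have c2 : centered P (fun om => \sum_i \sum_r 2 * beta i k.+1 *
    ((\1_B om * (H i k.+1 *m err k om i) r 0) * w i k.+1 om r 0)).
  apply: centered_sum => i _; apply: centered_sum => r _; apply: centeredZ.
  apply: (@centered_mds _ _ _ P (Fsig w dn k) _ _ (1 + `|Hbar ^+ 2 * lam|)) => //.
  - exact: Fsig_sigma.
  - exact: Fsig_meas.
  - by apply: measurable_fun_Fsig; exact: measurable_funM.
  - apply: indic_mul_bound => om hB.
    apply: (@le_trans _ _ (Hbar ^+ 2 * energy k om)); last first.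
      by rewrite ler_pM2l ?exprn_gt0 // Blam.
    apply: (@le_trans _ _ (Hbar ^+ 2 * dot (err k om i) (err k om i))); last first.
      by rewrite ler_pM2l ?exprn_gt0 // dot_err_le.
    apply: le_trans (@H_dot_le i k.+1 _ isT).
    rewrite dotE (bigD1 r) //= -expr2 lerDl; apply: sumr_ge0 => q _.
    by rewrite -expr2 sqr_ge0.
  - exact: (@w_mds i k.+1 isT r).
apply: eq_centered (centeredD c1 c2) => om; rewrite /noise mulrDr !mulr_sumr.
congr (_ + _); apply: eq_bigr => i _; rewrite mulr_sumr; apply: eq_bigr => j _; ring.
Qed.

Variables (rho : R) (Y : 'I_N -> nat -> T -> \bar R).
Hypothesis rho_gt2 : 2 < rho.
Hypothesis w_mom : forall (i : 'I_N) (k : nat), (1 <= k)%N ->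
  is_cond_exp_nonneg P (Fwsig w k.-1)
    (fun om => ((vnorm (w i k om)) `^ rho)%:E) (Y i k).

Lemma sqr_le_powR (x : R) : 0 <= x -> x ^+ 2 <= 1 + x `^ rho.
Proof.
move=> x0; have [x1|/ltW x1] := leP x 1.
  have : x ^+ 2 <= 1 by rewrite expr_le1.
  by have := powR_ge0 x rho; lra.
have : x `^ 2%:R <= x `^ rho by rewrite ler_powR // ltW.
by rewrite powR_mulrn //; have := powR_ge0 x rho; lra.
Qed.

Lemma dot_w_meas i k : measurable_fun setT (fun om => dot (w i k om) (w i k om)).
Proof.
rewrite (_ : (fun om => _) = (fun om => \sum_r w i k om r 0 * w i k om r 0)).
  by apply: measurable_sum => r; exact: measurable_funM.
by apply/funext => om; rewrite dotE.
Qed.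

Lemma dot_w_moment i k (D : set T) (M : R) : Fwsig w k D -> 0 <= M ->
  (forall om, D om -> (Y i k.+1 om <= M%:E)%E) ->
  (\int[P]_(om in D) (dot (w i k.+1 om) (w i k.+1 om))%:E <= (1 + M)%:E)%E.
Proof.
move=> FD M0 DM; have mD : measurable D by exact: Fwsig_meas FD.
have [Y0 [mY YE]] := w_mom i (ltn0Sn k).
have mpow : measurable_fun setT (fun om => vnorm (w i k.+1 om) `^ rho).
  apply: (measurableT_comp (measurable_powR rho)).
  rewrite (_ : (fun om => _) =
    (fun om => (dot (w i k.+1 om) (w i k.+1 om)) `^ (2^-1))).
    exact: (measurableT_comp (measurable_powR _) (dot_w_meas i k.+1)).
  by apply/funext => om; rewrite -vnorm_sqr -powR_mulrn ?sqrtr_ge0 // -powRrM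
    divff ?powRr1 ?sqrtr_ge0.
have mYT : measurable_fun setT (Y i k.+1).
  by move=> _ B mB; rewrite setTI; apply: (@Fwsig_meas _ _ _ _ _ w w_meas k); exact: mY.
apply: (@le_trans _ _ (\int[P]_(om in D) (1%:E + (vnorm (w i k.+1 om) `^ rho)%:E))%E).
  apply: ge0_le_integral => //.
  - by move=> om _; rewrite lee_fin dot_ge0.
  - by apply/measurable_EFinP; apply: measurable_funS (dot_w_meas i k.+1).
  - apply: emeasurable_funD => //.
    by apply/measurable_EFinP; apply: measurable_funS mpow.
  - by move=> om _; rewrite -EFinD lee_fin -vnorm_sqr sqr_le_powR ?sqrtr_ge0.
rewrite ge0_integralD //; last 2 first.
- by move=> om _; rewrite lee_fin powR_ge0.
- by apply/measurable_EFinP; apply: measurable_funS mpow.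
rewrite EFinD; apply: leeD.
  by rewrite integral_cst // mul1e probability_le1.
rewrite -YE //; apply: (@le_trans _ _ (\int[P]_(om in D) cst M%:E om)%E).
  by apply: ge0_le_integral => //; exact: measurable_funS mYT.
rewrite integral_cst // -[leRHS]mule1; apply: lee_wpmul2l; rewrite ?lee_fin //.
exact: probability_le1.
Qed.

Lemma Fwsig_Y_le k (M : R) :
  Fwsig w k [set om | forall i, (Y i k.+1 om <= M%:E)%E].
Proof.
have -> : [set om | forall i, (Y i k.+1 om <= M%:E)%E] =
    \bigcap_(i in [set: 'I_N]) (Y i k.+1 @^-1` [set y | (y <= M%:E)%E]).
  by apply/seteqP; split => om /= h i; [move=> _; exact: h|exact: (h i I)].
apply: (@fin_bigcap_measurable _ (g_sigma_algebraType (Gw w k))) => // i _.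
have [_ [mY _]] := w_mom i (ltn0Sn k); apply: mY.
by rewrite -set_itvNyc; exact: emeasurable_itv.
Qed.

(** Integrates [energy_step_le] over B. As [noise] is signed, its mean can be removed only once the
    remaining bound g is integrable on B, which the level lam ensures. *)
Lemma energy_integral_le k (B : set T) (lam M : R) : 0 <= M ->
  Fsig w dn k B -> B `<=` [set om | forall i, (Y i k.+1 om <= M%:E)%E] ->
  (forall om, B om -> energy k om <= lam) ->
  (\int[P]_(om in B) (energy k.+1 om)%:E <=
    (1 + growth k)%:E * \int[P]_(om in B) (energy k om)%:E +
    (drift k + 4 * Hbar ^+ 2 * (1 + M) * \sum_i beta i k.+1 ^+ 2)%:E)%E.
Proof.
move=> M0 FB BY Blam; have mB : measurable B by exact: Fsig_meas FB.
have mEn j D : measurable_fun D (energy j).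
  apply: measurable_funS (_ : measurable_fun setT (energy j)) => //.
  exact: (measurable_fun_Fsig_T w_meas d_meas (@energy_meas j)).
have [Inoise noise0] := noise_centered FB Blam.
have beta2_ge0 : 0 <= \sum_i beta i k.+1 ^+ 2.
  by apply: sumr_ge0 => i _; exact: sqr_ge0.
have growth_ge0 : 0 <= growth k by rewrite /growth mulr_ge0 // mulr_ge0 // sqr_ge0.
have drift_ge0 : 0 <= drift k.
  by rewrite /drift mulr_ge0 //; apply: sumr_ge0 => i _; exact: sqr_ge0.
have wsq_ge0 om : 0 <= wsq k om.
  apply: mulr_ge0; first by rewrite mulr_ge0 ?sqr_ge0.
  apply: sumr_ge0 => i _.
  by rewrite mulr_ge0 ?sqr_ge0 ?dot_ge0.
have mwsq : measurable_fun setT (wsq k).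
  apply: measurable_funM => //; apply: measurable_sum => i.
  by apply: measurable_funM => //; exact: dot_w_meas.
pose D := [set om | forall i, (Y i k.+1 om <= M%:E)%E].
have FD : Fwsig w k D by exact: Fwsig_Y_le.
have mD : measurable D by exact: Fwsig_meas FD.
have int_wsq : (\int[P]_(om in B) (wsq k om)%:E <=
    (4 * Hbar ^+ 2 * (1 + M) * \sum_i beta i k.+1 ^+ 2)%:E)%E.
  (* On D, an event of the past of w alone, [Y] does represent the conditional moment. *)
  apply: (@le_trans _ _ (\int[P]_(om in D) (wsq k om)%:E)%E).
    apply: ge0_subset_integral => //.
    - by apply/measurable_EFinP; exact: measurable_funS mwsq.
    - by move=> om _; rewrite lee_fin.
  rewrite /wsq.
  under eq_integral do rewrite EFinM -sumEFin.
  have H0 : 0 <= 4 * Hbar ^+ 2 by rewrite mulr_ge0 ?sqr_ge0.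
  rewrite ge0_integralZl ?lee_fin //; last 2 first.
  - apply: emeasurable_sum => i; apply/measurable_EFinP.
    by apply: measurable_funM => //; apply: measurable_funS (dot_w_meas i k.+1).
  - move=> om _; apply: sume_ge0 => i _.
    by rewrite lee_fin mulr_ge0 ?sqr_ge0 ?dot_ge0.
  have -> : (4 * Hbar ^+ 2 * (1 + M) * \sum_i beta i k.+1 ^+ 2)%:E =
      ((4 * Hbar ^+ 2)%:E * ((1 + M) * \sum_i beta i k.+1 ^+ 2)%R%:E)%E.
    by rewrite -EFinM (mulrA (4 * Hbar ^+ 2)).
  apply: lee_wpmul2l; first by rewrite lee_fin.
  rewrite ge0_integral_sum //; last 2 first.
  - move=> i; apply/measurable_EFinP.
    by apply: measurable_funM => //; apply: measurable_funS (dot_w_meas i k.+1).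
  - by move=> i om _; rewrite lee_fin mulr_ge0 ?sqr_ge0 ?dot_ge0.
  rewrite mulr_sumr -sumEFin; apply: lee_sum => i _.
  under eq_integral do rewrite EFinM.
  rewrite ge0_integralZl ?lee_fin ?sqr_ge0 //; last 2 first.
  - by apply/measurable_EFinP; apply: measurable_funS (dot_w_meas i k.+1).
  - by move=> om _; rewrite lee_fin dot_ge0.
  rewrite (mulrC (1 + M)) (EFinM (beta i k.+1 ^+ 2)); apply: lee_wpmul2l; first by rewrite lee_fin sqr_ge0.
  by apply: dot_w_moment FD M0 _ => om; apply.
pose g om := (1 + growth k) * energy k om + (drift k + wsq k om).
have g_ge0 om : 0 <= g om.
  apply: addr_ge0; last exact: addr_ge0.
  by apply: mulr_ge0; [exact: addr_ge0|exact: energy_ge0].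
have mg : measurable_fun setT g.
  apply: measurable_funD; first exact: measurable_funM.
  exact: measurable_funD.
have int_g : (\int[P]_(om in B) (g om)%:E <=
    (1 + growth k)%:E * \int[P]_(om in B) (energy k om)%:E +
    (drift k + 4 * Hbar ^+ 2 * (1 + M) * \sum_i beta i k.+1 ^+ 2)%:E)%E.
  under eq_integral do rewrite EFinD.
  rewrite ge0_integralD //; last 4 first.
  - by move=> om _; rewrite lee_fin; apply: mulr_ge0; [exact: addr_ge0|exact: energy_ge0].
  - by apply/measurable_EFinP; exact: measurable_funM.
  - by move=> om _; rewrite lee_fin addr_ge0.
  - apply/measurable_EFinP; apply: measurable_funD => //.
    exact: measurable_funS mwsq.
  apply: leeD.
    under eq_integral do rewrite EFinM.
    rewrite ge0_integralZl ?lee_fin ?addr_ge0 //; first exact/measurable_EFinP.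
    by move=> om _; rewrite lee_fin energy_ge0.
  under eq_integral do rewrite EFinD.
  rewrite ge0_integralD //; last 2 first.
  - by move=> om _; rewrite lee_fin.
  - by apply/measurable_EFinP; exact: measurable_funS mwsq.
  rewrite EFinD; apply: leeD => //.
  rewrite integral_cst // -[leRHS]mule1; apply: lee_wpmul2l; rewrite ?lee_fin //.
  exact: probability_le1.
have Ig : P.-integrable B (EFin \o g).
  apply/integrableP; split.
    by apply/measurable_EFinP; exact: measurable_funS mg.
  under eq_integral do rewrite /= ger0_norm //.
  apply: (le_lt_trans int_g); apply: lte_add_pinfty; last exact: ltry.
  apply: lte_mul_pinfty; rewrite ?lee_fin ?addr_ge0 //.
  apply: (@le_lt_trans _ _ (\int[P]_(om in B) cst `|lam|%:E om)%E).
    apply: ge0_le_integral => //.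
    - by move=> om _; rewrite lee_fin energy_ge0.
    - exact/measurable_EFinP.
    - by move=> om hB; rewrite lee_fin (le_trans (Blam _ hB)) // ler_norm.
  rewrite integral_cst //; apply: lte_mul_pinfty; rewrite ?lee_fin //.
  by rewrite (le_lt_trans (probability_le1 P mB)) // ltry.
have noiseB : (\int[P]_(om in B) (\1_B om * noise k om)%:E = 0)%E.
  rewrite -noise0 integral_mkcond; apply: eq_integral => om _; rewrite patchE.
  case: ifPn => // hB; rewrite indicE (negbTE hB) mul0r //.
have InoiseB : P.-integrable B (EFin \o (fun om => \1_B om * noise k om)).
  exact: integrableS Inoise.
apply: le_trans int_g.
apply: (@le_trans _ _ (\int[P]_(om in B) ((g om)%:E + (\1_B om * noise k om)%:E))%E).
  apply: ge0_le_integral => //.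
  - by move=> om _; rewrite lee_fin energy_ge0.
  - exact/measurable_EFinP.
  - apply: emeasurable_funD; last by case/integrableP: InoiseB.
    by case/integrableP: Ig.
  - move=> om hB; rewrite -EFinD lee_fin indicE mem_set // mul1r.
    exact: energy_step_le.
by rewrite integralD // noiseB adde0.
Qed.

Hypothesis Y_bnd : {ae P, forall om, exists M : R, forall (i : 'I_N) (k : nat),
  (1 <= k)%N -> (Y i k om <= M%:E)%E}.
Hypothesis alpha_sq : forall i j, 0 < a i j ->
  (\sum_(1 <= k <oo) ((alpha i j k) ^+ 2)%:E < +oo)%E.
Hypothesis beta_sq : forall i, (\sum_(1 <= k <oo) ((beta i k) ^+ 2)%:E < +oo)%E.

Lemma beta_psums : bounded_psums (fun k => \sum_i beta i k.+1 ^+ 2).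
Proof.
apply: bounded_psums_sum => i _.
apply: (@bounded_psums_series _ (fun k => beta i k ^+ 2)) => [k _|//].
exact: sqr_ge0.
Qed.

Lemma drift_psums : bounded_psums drift.
Proof.
apply: bounded_psumsZ => //; apply: bounded_psums_sum => i _.
apply: (@bounded_psums_le _ _ (fun k => 2 ^+ size (index_enum 'I_N) *
    \sum_(j < N | 0 < a i j) (2 * a i j) ^+ 2 * alpha i j k.+1 ^+ 2)).
  move=> k; apply: (le_trans (sqr_sum_le _ _ _)).
  rewrite le_eqVlt; apply/orP; left; apply/eqP; congr (_ * _).
  by apply: eq_bigr => j _; ring.
apply: bounded_psumsZ; first exact: exprn_ge0.
apply: bounded_psums_sum => j aij; apply: bounded_psumsZ; first exact: sqr_ge0.
apply: (@bounded_psums_series _ (fun k => alpha i j k ^+ 2)) => [k _|].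
  exact: sqr_ge0.
exact: alpha_sq.
Qed.

(** The bound on the conditional moments is random: the argument is run for every natural M, and
    each path with a real bound is covered by a larger integer. *)
Lemma energy_bounded : {ae P, forall om, exists C, forall k, energy k om <= C}.
Proof.
have H0 : 0 <= 4 * Hbar ^+ 2 by rewrite mulr_ge0 ?sqr_ge0.
have b0 k : 0 <= \sum_i beta i k.+1 ^+ 2 by apply: sumr_ge0 => i _; exact: sqr_ge0.
have hM (M : nat) : {ae P, forall om,
    (forall k, [set om | forall i, (Y i k.+1 om <= M%:R%:E)%E] om) ->
    exists C, forall k, energy k om <= C}.
  have [K1 hK1] : bounded_psums growth.
    by apply: bounded_psumsZ; [rewrite mulr_ge0 ?sqr_ge0|exact: beta_psums].
  pose r k := drift k + 4 * Hbar ^+ 2 * (1 + M%:R) * \sum_i beta i k.+1 ^+ 2.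
  have [K2 hK2] : bounded_psums r.
    apply: bounded_psumsD; first exact: drift_psums.
    by apply: bounded_psumsZ; [apply: mulr_ge0 => //; exact: addr_ge0|exact: beta_psums].
  apply: (@robbins_siegmund_bounded _ _ _ P (Fsig w dn) energy _ growth r
    (\sum_i dot (theta0 i - theta) (theta0 i - theta)) K1 K2 _ _ _ _ _ _ _ _ _ hK1 hK2).
  - exact: Fsig_sigma.
  - exact: Fsig_meas.
  - exact: Fsig_incr.
  - exact: energy_ge0.
  - by move=> k; apply: measurable_fun_Fsig; exact: energy_meas.
  - by move=> k; apply: Fwsig_Fsig; exact: Fwsig_Y_le.
  - by [].
  - by move=> k; apply: mulr_ge0 => //; rewrite mulr_ge0 ?sqr_ge0.
  - move=> k; apply: addr_ge0; last first.
      by apply: mulr_ge0 => //; apply: mulr_ge0 => //; exact: addr_ge0.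
    by apply: mulr_ge0 => //; apply: sumr_ge0 => i _; exact: sqr_ge0.
  - by move=> k lam B FB BA Blam; exact: (energy_integral_le (ler0n _ M) FB BA Blam).
apply: filterS2 (ae_foralln hM) Y_bnd => om hMom [M hY].
apply: (hMom (Num.truncn M).+1) => k i; apply: (le_trans (hY i k.+1 isT)).
by rewrite lee_fin ltW // truncnS_gt.
Qed.

(** The bound is a natural number so that the levels of the rare events form a countable family. *)
Lemma xval_bounded : {ae P, forall om, exists L : nat, forall k i,
  `|xval k.+1 (th k om i)| <= L%:R}.
Proof.
apply: filterS energy_bounded => om [C hC].
exists (Num.truncn (2 + C + dot theta theta)).+1 => k i.
apply: le_trans (ltW (truncnS_gt _)).
have -> : th k om i = err k om i + theta by rewrite subrK.
rewrite xval_dot dotDr; apply: (le_trans (ler_normD _ _)).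
have le1 (x y : R) : x ^+ 2 <= y -> `|x| <= 1 + y.
  rewrite -[x ^+ 2]real_normK ?num_real // => h.
  have := sqr_ge0 (`|x| - 1); nra.
have h1 : `|dot (phi n k.+1) (err k om i)| <= 1 + C.
  apply: le1; apply: le_trans (hC k); apply: le_trans (dot_err_le _ _ i).
  exact: dot_sqr_le (phi_dot_le1 _ _).
have h2 : `|dot (phi n k.+1) theta| <= 1 + dot theta theta.
  by apply: le1; exact: dot_sqr_le (phi_dot_le1 _ _).
lra.
Qed.

End Energy.

(** * Partial sums of t^-v *)

Section PowerSums.
Context {R : realType}.

(** The tangent line of the concave power at 1. With y = exp(u), apply 1 + x <= exp(x) at (1 - r) u
    and at - r u, and add with weights r and 1 - r times exp(r u): the terms in u cancel. *)
Lemma powR_le_linear (y r : R) : 0 <= y -> 0 < r <= 1 -> y `^ r <= r * y + (1 - r).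
Proof.
move=> y0 /andP[r0 r1]; have [->|yn0] := eqVneq y 0.
  by rewrite powR0 ?gt_eqF // mulr0 add0r subr_ge0.
have yp : 0 < y by rewrite lt_neqAle eq_sym yn0.
rewrite /powR (negbTE yn0); set u := ln y.
have yE : y = expR u by rewrite lnK.
have h1 := expR_ge1Dx ((1 - r) * u); have h2 := expR_ge1Dx (- (r * u)).
have e0 := expR_gt0 (r * u).
have -> : y = expR (r * u) * expR ((1 - r) * u).
  by rewrite -expRD -mulrDl addrCA subrr addr0 mul1r.
have E2 : 1 = expR (r * u) * expR (- (r * u)) by rewrite -expRD subrr expR0.
have h1' := ler_wpM2l (ltW e0) h1; have h2' := ler_wpM2l (ltW e0) h2.
rewrite -E2 in h2'.
have h3 := ler_wpM2l (ltW r0) h1'.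
have h4 : (1 - r) * (expR (r * u) * (1 - r * u)) <= (1 - r) * 1.
  by apply: ler_wpM2l => //; rewrite subr_ge0.
lra.
Qed.

(** A discrete integral comparison; the induction step is the tangent inequality at y = k / (k + 1)
    with exponent 1 - v. *)
Lemma sum_powR_le (v : R) k : 0 <= v < 1 ->
  \sum_(t < k) t.+1%:R `^ (- v) <= k%:R `^ (1 - v) / (1 - v).
Proof.
move=> /andP[v0 v1]; have r0 : 0 < 1 - v by rewrite subr_gt0.
elim: k => [|k IH]; first by rewrite big_ord0 divr_ge0 ?powR_ge0 // ltW.
rewrite big_ord_recr /=; apply: (le_trans (lerD IH (lexx _))).
have k0 : 0 < k.+1%:R :> R by rewrite ltr0n.
pose y : R := k%:R / k.+1%:R.
have y0 : 0 <= y by rewrite divr_ge0.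
have kE : k%:R = y * k.+1%:R :> R by rewrite /y divfK // gt_eqF.
have -> : k.+1%:R `^ (- v) = k.+1%:R `^ (1 - v) / k.+1%:R :> R.
  rewrite (addrC 1) powRD ?powRr1 ?mulfK ?(ltW k0) ?pnatr_eq0 //.
  by apply/implyP.
rewrite {1}kE powRM ?(ltW k0) //.
set K := k.+1%:R `^ (1 - v).
have K0 : 0 <= K by exact: powR_ge0.
have hy : y `^ (1 - v) <= (1 - v) * y + (1 - (1 - v)).
  by apply: powR_le_linear => //; rewrite r0 gerBl.
have yE : 1 - y = k.+1%:R^-1.
  rewrite /y -[X in X - _](divff (lt0r_neq0 k0)) -mulrBl -natrB //.
  by rewrite subSnn div1r.
have -> : y `^ (1 - v) * K / (1 - v) + K / k.+1%:R =
   K / (1 - v) * (y `^ (1 - v) + (1 - v) * (1 - y)).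
  by rewrite yE; move: (k.+1%:R^-1) => Z; field; rewrite gt_eqF.
rewrite -[leRHS]mulr1; apply: ler_wpM2l; first by rewrite divr_ge0 // ltW.
lra.
Qed.

End PowerSums.

(** * Counting large dithers *)

Section RareEvents.
Context {R : realType} {dsp : measure_display} {T : measurableType dsp}.
Variable P : probability T R.
Variables (N : nat) (m : 'I_N -> nat).
Variable w : forall i : 'I_N, nat -> T -> 'cV[R]_(m i).
Variable dn : 'I_N -> nat -> T -> R.
Hypothesis w_meas : forall (i : 'I_N) (k : nat) (r : 'I_(m i)),
  measurable_fun setT (fun om => w i k om r 0).
Hypothesis d_meas : forall (i : 'I_N) (k : nat), measurable_fun setT (dn i k).
Hypothesis d_lap : forall (i : 'I_N) (k : nat), (1 <= k)%N -> forall x : R,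
  P [set om | dn i k om <= x] = (laplace_cdf x)%:E.
Hypothesis d_indep : mutually_independent P
  (fun o : option ('I_N * nat) => match o with
     | None => Fw_all w
     | Some (i, k) => sig_d dn i k.+1
     end).
Variables (i : 'I_N) (v c L : R).
Hypothesis c_gt0 : 0 < c.
Hypothesis v01 : 0 <= v < 1.

Local Notation S k := (g_sigma_algebraType (Gw w k `|` Gd dn k)).

(** Index k stands for time k + 1, and c for b_ij. The fixed level L replaces |x_i|, so the event
    depends on the new dither only. *)
Definition exceeds k om : bool := v * c * ln k.+1%:R < L + c * `|dn i k.+1 om|.

Definition exceed_bound k : R := expR (L / c) * k.+1%:R `^ (- v).

Lemma laplace_abs_gt (X : T -> R) (y : R) : measurable_fun setT X ->
  (forall x, P [set om | X om <= x] = (laplace_cdf x)%:E) ->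
  (P [set om | (y < `|X om|)%R] <= (expR (- y))%:E)%E.
Proof.
move=> mX lapX.
have mabs : measurable [set om | y < `|X om|].
  have -> : [set om | y < `|X om|] = (fun om => `|X om|) @^-1` [set z | y < z] by [].
  rewrite -set_itvoy -[X in measurable X]setTI.
  have : measurable_fun setT (fun om => `|X om|) by exact: measurableT_comp.
  exact.
have [y0|y0] := ltP y 0.
  apply: (le_trans (probability_le1 P mabs)); rewrite lee_fin.
  by rewrite -expR0 ler_expR oppr_ge0 ltW.
have mle z : measurable [set om | X om <= z].
  by rewrite -[X in measurable X]setTI; exact: measurable_fun_le.
have mgt : measurable [set om | y < X om].
  have -> : [set om | y < X om] = X @^-1` [set z | y < z] by [].
  by rewrite -set_itvoy -[X in measurable X]setTI; exact: mX.
apply: (@le_trans _ _ (P ([set om | y < X om] `|` [set om | X om <= - y]))).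
  apply: le_measure; rewrite ?inE //; first exact: measurableU.
  move=> om /=; rewrite lter_normr => /orP[h|h]; first by left.
  by right; rewrite /= lerNr; exact: ltW.
have hU : (P ([set om | (y < X om)%R] `|` [set om | (X om <= - y)%R]) <=
    P [set om | (y < X om)%R] + P [set om | (X om <= - y)%R])%E.
  exact: measureU2 mgt (mle (- y)).
apply: (le_trans hU).
rewrite lapX (laplace_gt mX lapX) -EFinD lee_fin laplace_cdfN.
rewrite /laplace_cdf ltNge y0 /=.
lra.
Qed.

Lemma exceeds_prob k : (P [set om | exceeds k om] <= (exceed_bound k)%:E)%E.
Proof.
pose y := (v * c * ln k.+1%:R - L) / c.
have -> : [set om | exceeds k om] = [set om | y < `|dn i k.+1 om|].
  apply/seteqP; split => om /=; rewrite /exceeds /y ltr_pdivrMr //; lra.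
apply: le_trans (laplace_abs_gt y (d_meas i k.+1) (d_lap i (ltn0Sn k))) _.
rewrite lee_fin /exceed_bound /powR pnatr_eq0 /= -expRD ler_expR /y.
rewrite le_eqVlt; apply/orP; left; apply/eqP; field; rewrite gt_eqF //.
Qed.

(** The denominators use the bound [exceed_bound] instead of the exact probability, hence a
    supermartingale and not a martingale. *)
Definition likelihood k om : R :=
  \prod_(t < k) ((1 + (exceeds t om)%:R) / (1 + exceed_bound t)).

Lemma exceed_bound_ge0 k : 0 <= exceed_bound k.
Proof. by rewrite mulr_ge0 ?expR_ge0 ?powR_ge0. Qed.

Lemma likelihood_ge0 k om : 0 <= likelihood k om.
Proof.
by apply: prodr_ge0 => t _; rewrite divr_ge0 // addr_ge0 // exceed_bound_ge0.
Qed.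

Lemma exceeds_meas_fun (d' : measure_display) (U : measurableType d') (D : U -> R) (z : R) :
  measurable_fun setT D ->
  measurable_fun setT (fun om => (z < L + c * `|D om|)%R%:R : R).
Proof.
move=> mD; apply: measurable_fun_b2r; apply: measurable_fun_ltr => //.
by apply: measurable_funD => //; apply: measurable_funM => //; exact: measurableT_comp.
Qed.

Lemma likelihood_meas k : measurable_fun [set: S k] (likelihood k).
Proof.
elim: k => [|k IH].
  by rewrite (_ : likelihood 0 = cst 1) //; apply/funext => om; rewrite /likelihood big_ord0.
rewrite (_ : likelihood k.+1 = (fun om => likelihood k om *
    ((1 + (exceeds k om)%:R) / (1 + exceed_bound k)))); last first.
  by apply/funext => om; rewrite /likelihood big_ord_recr.
apply: measurable_funM; first exact: measurable_fun_FsigS.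
apply: measurable_funM => //; apply: measurable_funD => //.
apply: (@exceeds_meas_fun _ (S k.+1)); exact: dn_Fsig_meas.
Qed.

(** By independence the new factor 1 + eta has conditional mean 1 + p, with p at most
    [exceed_bound k]. The weight g gathers all that is known from the past, including B and the new
    denominator. *)
Lemma likelihood_integral_le k (B : set T) : Fsig w dn k B ->
  (\int[P]_(om in B) (likelihood k.+1 om)%:E <=
   \int[P]_(om in B) (likelihood k om)%:E)%E.
Proof.
move=> FB; have mB : measurable B by exact: Fsig_meas FB.
pose E := [set om | exceeds k om].
pose C := [set y : R | v * c * ln k.+1%:R < L + c * `|y|].
have mC : measurable C.
  have -> : C = (fun y : R => L + c * `|y|) @^-1` [set z | v * c * ln k.+1%:R < z] by [].
  rewrite -set_itvoy -[X in measurable X]setTI.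
  have : measurable_fun setT (fun y : R => L + c * `|y|).
    by apply: measurable_funD => //; apply: measurable_funM => //; exact: measurableT_comp.
  exact.
have EC : E = dn i k.+1 @^-1` C by [].
have mE : measurable E by rewrite EC -[X in measurable X]setTI; exact: d_meas.
pose p := fine (P E).
have pE : P E = p%:E by rewrite fineK // fin_num_measure.
have p0 : 0 <= p by exact: fine_ge0.
have pq : p <= exceed_bound k by rewrite -lee_fin -pE; exact: exceeds_prob.
pose q1 := 1 + exceed_bound k.
have q1_gt0 : 0 < q1 by rewrite ltr_wpDr // exceed_bound_ge0.
pose g om := \1_B om * likelihood k om / q1.
have g0 om : 0 <= g om.
  by rewrite divr_ge0 ?(ltW q1_gt0) // mulr_ge0 ?likelihood_ge0.
have mgS : measurable_fun [set: S k] g.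
  apply: measurable_funM => //; apply: measurable_funM; last exact: likelihood_meas.
  exact: indic_Fsig_meas.
have mg : measurable_fun setT g by exact: (measurable_fun_Fsig_T w_meas d_meas mgS).
have mind : measurable_fun setT (fun om => 1 + \1_E om : R).
  by apply: measurable_funD => //; exact: measurable_indic.
have key : (\int[P]_om ((1 + \1_E om)%:E * (g om)%:E) =
            \int[P]_om ((1 + p)%:E * (g om)%:E))%E.
  apply: (@integral_mul_eq _ _ _ P (Fsig w dn k) (fun om => (1 + \1_E om)%:E)
    (cst (1 + p)%:E)) => //.
  - exact: Fsig_sigma.
  - exact: Fsig_meas.
  - exact/measurable_EFinP.
  - by move=> om; rewrite lee_fin addr_ge0.
  - move=> A FA; have mA : measurable A by exact: Fsig_meas FA.
    rewrite integral_cst //; under eq_integral do rewrite EFinD.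
    rewrite ge0_integralD //; last first.
      by apply/measurable_EFinP; apply: measurable_indic.
    have hAE : P (A `&` E) = (p%:E * P A)%E.
      by rewrite EC (Fsig_indep_dn w_meas d_meas d_indep i FA mC) -EC pE muleC.
    rewrite integral_cst // integral_indic // setIC -[X in (_ + X)%E]/(P (A `&` E)).
    by rewrite hAE EFinD [RHS]ge0_muleDl ?lee_fin.
  - exact: measurable_fun_Fsig.
have -> : (\int[P]_(om in B) (likelihood k.+1 om)%:E =
    \int[P]_om ((1 + \1_E om)%:E * (g om)%:E))%E.
  rewrite integral_mkcond; apply: eq_integral => om _; rewrite patchE -EFinM /g !indicE.
  have -> : (om \in E) = exceeds k om by rewrite /E mem_setE.
  case: ifP => hB; last by rewrite mul0r mul0r mulr0.
  by rewrite mul1r /likelihood big_ord_recr /= -/q1; congr _%:E; rewrite mulrCA.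
rewrite key.
apply: (@le_trans _ _ (\int[P]_om (\1_B om * likelihood k om)%:E)%E).
  apply: ge0_le_integral => //.
  - by move=> om _; rewrite -EFinM lee_fin mulr_ge0 // addr_ge0.
  - by apply: emeasurable_funM => //; exact/measurable_EFinP.
  - apply/measurable_EFinP; apply: (measurable_fun_Fsig_T w_meas d_meas (k := k)).
    by apply: measurable_funM; [exact: indic_Fsig_meas|exact: likelihood_meas].
  - move=> om _; rewrite -EFinM lee_fin /g mulrCA -[leRHS]mulr1.
    apply: ler_wpM2l; first by rewrite mulr_ge0 ?likelihood_ge0.
    by rewrite ler_pdivrMr // mul1r lerD2l.
rewrite [leRHS]integral_mkcond le_eqVlt; apply/orP; left; apply/eqP.
apply: eq_integral => om _; rewrite patchE indicE.
by case: ifP => _; rewrite ?mul1r ?mul0r.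
Qed.

(* [likelihood] is a nonnegative supermartingale, hence bounded; since
   [exp (x / 2) <= 1 + x] on {0, 1}, taking logarithms bounds the count. *)
Lemma exceeds_rate : {ae P, forall om, exists C, forall k, (1 <= k)%N ->
  \sum_(t < k) (exceeds t om)%:R <= C * k%:R `^ (1 - v)}.
Proof.
have : {ae P, forall om, (forall k : nat, setT om) ->
    exists C, forall k, likelihood k om <= C}.
  apply: (@almost_supermartingale_bounded _ _ _ P (Fsig w dn) _ _ _ likelihood
    (fun=> setT) (fun=> 0) 1 0).
  - exact: Fsig_sigma.
  - exact: Fsig_meas.
  - exact: Fsig_incr.
  - exact: likelihood_ge0.
  - by move=> k; apply: measurable_fun_Fsig; exact: likelihood_meas.
  - by move=> k; case: (Fsig_sigma w dn k) => F0 FC _; rewrite -(setD0 setT); exact: FC.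
  - by move=> om; rewrite /likelihood big_ord0.
  - by move=> k; rewrite big1.
  - by move=> k lam B FB _ _; rewrite adde0; exact: likelihood_integral_le.
apply: filterS => om /(_ (fun=> I))[C hC].
have /andP[v0 v1] := v01; have r0 : 0 < 1 - v by rewrite subr_gt0.
(* The factors 2 undo the half in exp(x / 2). The additive |C| is absorbed because k^(1 - v) >= 1,
   and |C| <= exp |C| spares the logarithm of C. *)
exists (2 * `|C| + 2 * (expR (L / c) / (1 - v))) => k k1.
have b0 := exceed_bound_ge0.
have h1 : expR (\sum_(t < k) (exceeds t om)%:R / 2) <=
    expR (`|C| + \sum_(t < k) exceed_bound t).
  apply: (@le_trans _ _ (\prod_(t < k) (1 + (exceeds t om)%:R))).
    rewrite expR_sum; apply: ler_prod => t _; rewrite expR_ge0 /=.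
    case: (exceeds t om) => /=; last by rewrite mul0r expR0 addr0.
    (* exp(-1/2) >= 1/2, that is exp(1/2) <= 2. *)
    have := expR_ge1Dx (- (1 / 2 : R)); rewrite expRN => h.
    have e0 := expR_gt0 (1 / 2 : R).
    have := ler_wpM2l (ltW e0) h; rewrite mulfV ?gt_eqF //; lra.
  rewrite expRD expR_sum; apply: (@le_trans _ _ (`|C| * \prod_(t < k) (1 + exceed_bound t))).
    have := hC k; rewrite /likelihood prodf_div ler_pdivrMr; last first.
      by apply: prodr_gt0 => t _; rewrite ltr_wpDr.
    move=> /le_trans; apply; apply: ler_wpM2r; last exact: ler_norm.
    by apply: prodr_ge0 => t _; rewrite addr_ge0.
  apply: ler_pM => //.
  - by apply: prodr_ge0 => t _; rewrite addr_ge0.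
  - by apply: le_trans (expR_ge1Dx _); rewrite lerDr.
  - by apply: ler_prod => t _; rewrite addr_ge0 //= expR_ge1Dx.
rewrite ler_expR -mulr_suml in h1.
have h2 : \sum_(t < k) exceed_bound t <= expR (L / c) * (k%:R `^ (1 - v) / (1 - v)).
  by rewrite -mulr_sumr ler_wpM2l ?expR_ge0 // sum_powR_le.
have k1r : 1 <= k%:R `^ (1 - v) :> R.
  rewrite -[leLHS](congr1 (@^~ (1 - v)) (powR1 R)).
  by apply: ge0_ler_powR; rewrite ?nnegrE ?ler1n // ltW.
have C0 := normr_ge0 C.
have h3 : `|C| <= `|C| * k%:R `^ (1 - v) by rewrite -[leLHS]mulr1 ler_wpM2l.
rewrite mulrDl.
have -> : 2 * (expR (L / c) / (1 - v)) * k%:R `^ (1 - v) =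
   2 * (expR (L / c) * (k%:R `^ (1 - v) / (1 - v))) by ring.
lra.
Qed.

End RareEvents.

(** * Consequences of the divergence of the sum of the z_k, and the minimal exponent *)

Section Exponents.
Context {R : realType} {N : nat}.
Variables (a nu : 'I_N -> 'I_N -> R) (alpha : 'I_N -> 'I_N -> nat -> R).
Variable beta : 'I_N -> nat -> R.
Hypothesis nu_ge0 : forall i j, 0 < a i j -> 0 <= nu i j.
Hypothesis alpha_gt0 : forall i j k, 0 < a i j -> (1 <= k)%N -> 0 < alpha i j k.
Hypothesis beta_gt0 : forall i k, (1 <= k)%N -> 0 < beta i k.

Lemma zmin_ge0 k : (1 <= k)%N -> (0 <= zmin a nu alpha beta k)%E.
Proof.
move=> k1; rewrite /zmin le_min; apply/andP; split; apply: le_bigmin => // i _.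
  apply: le_bigmin => // j aij; rewrite lee_fin divr_ge0 ?powR_ge0 // ltW //.
  exact: alpha_gt0.
by rewrite lee_fin ltW // beta_gt0.
Qed.

Lemma zmin_le i j k : 0 < a i j ->
  (zmin a nu alpha beta k <= (alpha i j k / k%:R `^ nu i j)%:E)%E.
Proof.
move=> aij; rewrite /zmin ge_min; apply/orP; left.
apply: (le_trans (bigmin_le_cond _ _ (erefl : xpredT i))).
exact: (bigmin_le_cond _ _ aij).
Qed.

Lemma nu_min_le i j : 0 < a i j -> nu_min a nu <= nu i j.
Proof.
move=> aij; rewrite /nu_min; set M := (X in fine X).
have MN : (M <= (nu i j)%:E)%E.
  apply: (le_trans (bigmin_le_cond _ _ (erefl : xpredT i))).
  exact: (bigmin_le_cond _ _ aij).
have M0 : (0 <= M)%E.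
  apply: le_bigmin => // i' _; apply: le_bigmin => // j' aij'.
  by rewrite lee_fin nu_ge0.
(* Without an edge the minimum would be +oo and [fine] would return 0; the edge (i, j) makes it
   finite. *)
have Mfin : M \is a fin_num by rewrite ge0_fin_numE // (le_lt_trans MN) // ltry.
by rewrite -lee_fin fineK.
Qed.

(** Telescoping: 1 / (x + 1)^2 <= 1 / x - 1 / (x + 1). The first term is treated apart, as 1 / 0 is
    0 here. *)
Lemma inv_sqr_psums : bounded_psums (fun k => (k.+1%:R : R) ^- 2).
Proof.
exists 2 => k; suff : \sum_(j < k) (j.+1%:R : R) ^- 2 <= 2 - k%:R^-1.
  by move=> /le_trans; apply; rewrite gerBl invr_ge0.
elim: k => [|k IH]; first by rewrite big_ord0 invr0 subr0.
rewrite big_ord_recr /=; case: k IH => [|k] IH.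
  by rewrite big_ord0 add0r expr1n invr1; lra.
apply: (le_trans (lerD IH (lexx _))).
have x0 : 0 < k.+1%:R :> R by rewrite ltr0n.
rewrite -(natr1 k.+1); move: (k.+1%:R : R) x0 => x x0.
have x10 : 0 < x + 1 by rewrite addr_gt0.
rewrite -subr_ge0.
have -> : 2 - (x + 1)^-1 - (2 - x^-1 + (x + 1) ^- 2) = (x * (x + 1) ^+ 2)^-1.
  by field; rewrite !gt_eqF.
by rewrite invr_ge0 mulr_ge0 ?sqr_ge0 // ltW.
Qed.

(** The bound k^(1 - v) / (1 - v) on the power sums makes sense only below 1. If nu >= 1, then z_k
    <= alpha_k / k <= alpha_k^2 + k^-2 has bounded partial sums. *)
Lemma nu_lt1 i j : 0 < a i j ->
  (\sum_(1 <= k <oo) ((alpha i j k) ^+ 2)%:E < +oo)%E ->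
  (\sum_(1 <= k <oo) zmin a nu alpha beta k = +oo)%E -> nu i j < 1.
Proof.
move=> aij asq zoo; rewrite ltNge; apply/negP => nu1.
have [K1 hK1] : bounded_psums (fun k => alpha i j k.+1 ^+ 2).
  apply: (@bounded_psums_series _ (fun k => alpha i j k ^+ 2)) => // k _.
  exact: sqr_ge0.
have [K2 hK2] := inv_sqr_psums.
suff : (\sum_(1 <= k <oo) zmin a nu alpha beta k <= (K1 + K2)%:E)%E by rewrite zoo.
apply: lime_le; first by apply: is_cvg_nneseries => k k1 _; exact: zmin_ge0.
apply: nearW => -[|n]; first by rewrite big_geq // lee_fin addr_ge0 //;
  [have := hK1 0%N|have := hK2 0%N]; rewrite big_ord0.
rewrite big_add1 /= big_mkord.
apply: (@le_trans _ _ (\sum_(k < n) (alpha i j k.+1 ^+ 2 + k.+1%:R ^- 2)%:E)%E).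
  apply: lee_sum => k _; apply: (le_trans (zmin_le _ aij)); rewrite lee_fin.
  have al0 := alpha_gt0 aij (ltn0Sn k).
  have k1 : 1 <= k.+1%:R :> R by rewrite ler1n.
  have k0 : 0 < k.+1%:R :> R by rewrite ltr0n.
  apply: (@le_trans _ _ (alpha i j k.+1 * k.+1%:R^-1)).
    rewrite ler_wpM2l ?(ltW al0) // lef_pV2 ?posrE ?powR_gt0 //.
    by rewrite -[leLHS]powRr1 ?(ltW k0) // ler_powR.
  rewrite -exprVn; set x := alpha i j k.+1; set y := k.+1%:R^-1.
  have := sqr_ge0 (x - y); have := sqr_ge0 (x + y); nra.
by rewrite sumEFin lee_fin big_split; apply: lerD; [exact: hK1|exact: hK2].
Qed.

End Exponents.

(** * From the counts of large dithers to the data rate *)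

Theorem theorem5p2
  (R : realType) (dsp : measure_display) (T : measurableType dsp)
  (P : probability T R)
  (N n : nat) (m : 'I_N -> nat)
  (a : 'I_N -> 'I_N -> R)
  (H : forall i : 'I_N, nat -> 'M[R]_(m i, n))
  (theta : 'cV[R]_n)
  (w : forall i : 'I_N, nat -> T -> 'cV[R]_(m i))
  (dn : 'I_N -> nat -> T -> R)
  (theta0 : 'I_N -> 'cV[R]_n)
  (nu b : 'I_N -> 'I_N -> R)
  (alpha : 'I_N -> 'I_N -> nat -> R)
  (beta : 'I_N -> nat -> R)
  (* network: symmetric nonnegative weights, (i,j) in E iff a i j > 0 *)
  (ha_sym : forall i j, a i j = a j i)
  (ha_ge0 : forall i j, 0 <= a i j)
  (* (A1) *)
  (Hbar : R) (hHbar_pos : 0 < Hbar)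
  (hH_bnd : forall (i : 'I_N) (k : nat), (1 <= k)%N ->
     forall x : 'cV[R]_n, vnorm (H i k *m x) <= Hbar * vnorm x)
  (p : nat) (hp : (0 < p)%N) (delta : R) (hdelta : 0 < delta)
  (hPE : forall k : nat, (1 <= k)%N -> forall x : 'cV[R]_n,
     delta * (x^T *m x) 0 0 <=
     (p%:R)^-1 * (x^T *m (\sum_(k <= t < k + p) \sum_(i < N) (H i t)^T *m H i t) *m x) 0 0)
  (* measurability of the noises *)
  (hw_meas : forall (i : 'I_N) (k : nat) (r : 'I_(m i)),
     measurable_fun setT (fun om => w i k om r 0))
  (hd_meas : forall (i : 'I_N) (k : nat), measurable_fun setT (dn i k))
  (* (A2) martingale difference sequence w.r.t. F_k *)
  (hw_mds : forall (i : 'I_N) (k : nat), (1 <= k)%N -> forall r : 'I_(m i),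
     measurable_wrt (Fsig w dn k) (fun om => w i k om r 0) /\
     cond_exp_zero P (Fsig w dn k.-1) (fun om => w i k om r 0))
  (* (A2) conditional rho-moment bound *)
  (hw_mom : exists rho : R, 2 < rho /\
     exists Y : 'I_N -> nat -> T -> \bar R,
       (forall (i : 'I_N) (k : nat), (1 <= k)%N ->
          is_cond_exp_nonneg P (Fwsig w k.-1)
            (fun om => ((vnorm (w i k om)) `^ rho)%:E) (Y i k)) /\
       {ae P, forall om, exists M : R, forall (i : 'I_N) (k : nat), (1 <= k)%N ->
          (Y i k om <= M%:E)%E})
  (* (A3) connectivity *)
  (hconn : \rank (laplacian a) = N.-1)
  (* (A4) d_{i,k} (k >= 1) i.i.d. Lap(0,1), mutually independent, and
     independent of all the w's *)
  (hd_lap : forall (i : 'I_N) (k : nat), (1 <= k)%N -> forall x : R,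
     P [set om | dn i k om <= x] = (laplace_cdf x)%:E)
  (hd_indep : mutually_independent P
     (fun o : option ('I_N * nat) => match o with
        | None => Fw_all w
        | Some (i, k) => sig_d dn i k.+1
        end))
  (* algorithm parameters *)
  (hnu : forall i j, 0 < a i j -> nu i j = nu j i /\ 0 <= nu i j)
  (hb : forall i j, 0 < a i j -> b i j = b j i /\ 0 < b i j)
  (halpha : forall i j k, 0 < a i j -> (1 <= k)%N ->
     alpha i j k = alpha j i k /\ 0 < alpha i j k)
  (hbeta : forall i k, (1 <= k)%N -> 0 < beta i k)
  (* (i) *)
  (halpha_sq : forall i j, 0 < a i j ->
     (\sum_(1 <= k <oo) ((alpha i j k) ^+ 2)%:E < +oo)%E)
  (halpha_ratio : forall i j, 0 < a i j ->
     exists M : R, forall k, (1 <= k)%N -> alpha i j k.+1 / alpha i j k <= M)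
  (* (ii) *)
  (hbeta_sq : forall i, (\sum_(1 <= k <oo) ((beta i k) ^+ 2)%:E < +oo)%E)
  (hbeta_ratio : forall i,
     exists M : R, forall k, (1 <= k)%N -> beta i k.+1 / beta i k <= M)
  (* (iii) *)
  (hz : (\sum_(1 <= k <oo) zmin a nu alpha beta k = +oo)%E) :
  {ae P, forall om, exists C : R, forall k : nat, (1 <= k)%N ->
     `| Brate a H theta w dn theta0 nu b alpha beta k om |
       <= C * (k%:R `^ (- nu_min a nu))}.
Proof.
have [rho [rho2 [Y [hY Ybnd]]]] := hw_mom.
have w_mds i k : (1 <= k)%N -> forall r : 'I_(m i),
    cond_exp_zero P (Fsig w dn k.-1) (fun om => w i k om r 0).
  by move=> k1 r; exact: (hw_mds i k k1 r).2.
have xbnd := xval_bounded theta theta0 ha_sym hHbar_pos hH_bnd hw_meas hd_meas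
  w_mds hd_lap hd_indep hnu hb halpha hbeta rho2 hY Ybnd halpha_sq hbeta_sq.
have nu0 i j : 0 < a i j -> 0 <= nu i j by move=> /hnu[].
have al0 i j k : 0 < a i j -> (1 <= k)%N -> 0 < alpha i j k.
  by move=> aij k1; exact: (halpha i j k aij k1).2.
have nu1 i j : 0 < a i j -> nu i j < 1.
  by move=> aij; exact: (nu_lt1 al0 hbeta aij (halpha_sq i j aij) hz).
(* Countably many almost sure statements, one for each edge and each natural level, hold together;
   the level of the path at hand is inserted afterwards. *)
have rate : {ae P, forall om, forall (e : 'I_N * 'I_N) (L : nat),
    0 < a e.1 e.2 -> exists C, forall k, (1 <= k)%N ->
    \sum_(t < k) (exceeds dn e.1 (nu e.1 e.2) (b e.1 e.2) L%:R t om)%:R <=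
      C * k%:R `^ (1 - nu e.1 e.2)}.
  apply: filter_forall => -[i j] /=; apply: ae_foralln => L.
  have [aij|naij] := boolP (0 < a i j); last by apply: aeW => om.
  have := exceeds_rate hw_meas hd_meas hd_lap hd_indep i L%:R (hb i j aij).2
    (_ : 0 <= nu i j < 1); rewrite nu0 // nu1 // => /(_ isT).
  by apply: filterS => om h _.
apply: filterS2 xbnd rate => om [L hL] hrate.
(* The edge condition is moved under the existential so that a constant is chosen for every ordered
   pair. *)
have /choice[Cf hCf] (e : 'I_N * 'I_N) : exists C, 0 < a e.1 e.2 ->
    forall k, (1 <= k)%N ->
    \sum_(t < k) (exceeds dn e.1 (nu e.1 e.2) (b e.1 e.2) L%:R t om)%:R <=
      C * k%:R `^ (1 - nu e.1 e.2).
  have [aij|] := boolP (0 < a e.1 e.2); last by exists 0.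
  by have [C hC] := hrate e L aij; exists C.
set E := @n_ordered_edges R N a.
have E0 : 0 <= E by apply: sumr_ge0 => i _; apply: sumr_ge0.
exists ((\sum_(i < N) \sum_(j < N | 0 < a i j) `|Cf (i, j)|) / E) => k k1.
have k0 : 0 < k%:R :> R by rewrite ltr0n.
rewrite /Brate -/E; set num := \sum_(i < N) _.
have zeta_le i j t : 0 < a i j ->
    zeta a H theta w dn theta0 nu b alpha beta i j t.+1 om <=
    (exceeds dn i (nu i j) (b i j) L%:R t om)%:R.
  move=> aij; rewrite /zeta /exceeds; case: ifPn => // h.
  rewrite (lt_le_trans h) //; apply: (le_trans (ler_normD _ _)).
  rewrite lerD ?hL // normrM ger0_norm // ltW //; exact: (hb i j aij).2.
have num0 : 0 <= num.
  apply: sumr_ge0 => i _; apply: sumr_ge0 => j _; apply: sumr_ge0 => t _.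
  by rewrite /zeta; case: ifP.
have num_le : num <= (\sum_(i < N) \sum_(j < N | 0 < a i j) `|Cf (i, j)|) *
    (k%:R * k%:R `^ (- nu_min a nu)).
  rewrite mulr_suml; apply: ler_sum => i _; rewrite mulr_suml; apply: ler_sum => j aij.
  rewrite big_add1 /= big_mkord.
  apply: (@le_trans _ _ (\sum_(t < k) (exceeds dn i (nu i j) (b i j) L%:R t om)%:R)).
    by apply: ler_sum => t _; exact: zeta_le.
  apply: (le_trans (hCf (i, j) aij k k1)) => /=.
  apply: (@le_trans _ _ (`|Cf (i, j)| * k%:R `^ (1 - nu i j))).
    by apply: ler_wpM2r; [exact: powR_ge0|exact: ler_norm].
  apply: ler_wpM2l => //; rewrite powRD ?powRr1 ?(ltW k0) //; last first.
    by apply/implyP => _; rewrite gt_eqF.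
  rewrite ler_pM2l //; apply: ler_powR; first by rewrite ler1n.
  by rewrite lerN2 (nu_min_le nu0).
(* E may be 0 when there is no edge; only the nonnegativity of its inverse is used, and the final
   identity treats that inverse as an atom. *)
have V0 : 0 <= k%:R^-1 * E^-1 by rewrite mulr_ge0 ?invr_ge0 // ltW.
rewrite invfM ger0_norm; last by rewrite mulr_ge0.
apply: (le_trans (ler_wpM2r V0 num_le)).
rewrite le_eqVlt; apply/orP; left; apply/eqP.
set S := \sum_(i < N) _; set q := _ `^ _.
have kk : k%:R * k%:R^-1 = 1 :> R by rewrite mulfV // gt_eqF.
transitivity (S / E * q * (k%:R * k%:R^-1)); last by rewrite kk mulr1.
by ring.
Qed.
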